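(* Let $K$ be a field of characteristic zero. Then \[\mathrm{Id}(F_2(\mathfrak{N}_3)) = \mathrm{Id}(F_3(\mathfrak{N}_3)) = \langle [x_1,x_2,x_3,x_4],\ s_4(x_1,x_2,x_3,x_4)\rangle^T.\]
   Context: All algebras are associative and unitary over a field $K$ of characteristic zero. $K\langle X\rangle$ is the free unitary associative algebra on $X=\{x_1,x_2,\dots\}$. Commutators are left-normed: $[a,b]=ab-ba$ and $[a_1,\dots,a_{m}]=[[a_1,\dots,a_{m-1}],a_m]$ for $m\ge 3$. $I_p$ is the two-sided ideal of $K\langle X\rangle$ generated by all commutators $[u_1,\dots,u_p]$, $u_i\in K\langle X\rangle$. $\mathfrak{N}_p$ is the variety of algebras satisfying $[x_1,\dots,x_{p+1}]=0$, and $F_n(\mathfrak{N}_p)=K\langle x_1,\dots,x_n\rangle/(I_{p+1}\cap K\langle x_1,\dots,x_n\rangle)$. $\mathrm{Id}(A)\subseteq K\langle X\rangle$ is the set of polynomial identities of an algebra $A$. A T-ideal is an ideal of $K\langle X\rangle$ closed under all $K$-algebra endomorphisms of $K\langle X\rangle$; $\langle S\rangle^T$ is the smallest T-ideal containing $S$. The standard polynomial is $s_m(x_1,\dots,x_m)=\sum_{\sigma\in S_m}(-1)^{\sigma}x_{\sigma(1)}\cdots x_{\sigma(m)}$, where $(-1)^\sigma$ is the sign of $\sigma$. *)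

(* Defs.v *)
From HB Require Import structures.
From mathcomp Require Import all_boot all_order all_algebra perm.
From mathcomp Require Import generic_quotient ring_quotient.
From mathcomp Require Import finmap boolp classical_sets.
From mathcomp.multinomials Require Import monalg.

Set Implicit Arguments.
Unset Strict Implicit.
Unset Printing Implicit Defensive.

Import GRing.Theory.
Local Open Scope ring_scope.
Local Open Scope classical_set_scope.
Local Open Scope quotient_scope.

Section FreeAlgebra.
Variables (K : fieldType) (I : choiceType).

(* The free unitary associative algebra K<I>: finitely supported K-linear
   combinations of words over I. *)
Definition freealg := {malg K[{fmonom I}]}.

HB.instance Definition _ := GRing.Lalgebra.on freealg.

Lemma freealg_scalerAr (c : K) (f g : freealg) : c *: (f * g) = f * (c *: g).
Proof.
have cE (h : freealg) : c *: h = h * c%:MP.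
  rewrite malgM_def malgZ_def fgmulgU.
  by apply: eq_bigr => w _; rewrite mulm1 mulrC.
by rewrite cE -mulrA -cE.
Qed.

HB.instance Definition _ :=
  GRing.Lalgebra_isAlgebra.Build K freealg freealg_scalerAr.

End FreeAlgebra.

HB.lock Definition fvar (K : fieldType) (I : choiceType) (i : I) : freealg K I :=
  << fmu i >>.
Arguments fvar K {I} i.

Section Evaluation.
Variables (K : fieldType) (I : choiceType) (A : algType K) (a : I -> A).

Definition eval_word (w : {fmonom I}) : A := \prod_(i <- (w : seq I)) a i.

Lemma eval_word_mmorphism : mmorphism eval_word.
Proof.
by split=> [w1 w2|]; rewrite /eval_word ?fmM ?big_cat // fm1 big_nil.
Qed.

HB.instance Definition _ :=
  isMultiplicative.Build {fmonom I} A eval_word eval_word_mmorphism.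

End Evaluation.

HB.lock Definition feval (K : fieldType) (I : choiceType) (A : algType K)
  (a : I -> A) (f : freealg K I) : A := mmap (in_alg A) (eval_word a) f.

Section EvaluationTheory.
Variables (K : fieldType) (I : choiceType) (A : algType K) (a : I -> A).
Local Notation ev := (feval a).

Lemma fevalE f : ev f = \sum_(w <- msupp f) f@_w *: eval_word a w.
Proof. by rewrite feval.unlock; apply: eq_bigr => w _; rewrite mulr_algl. Qed.

Lemma feval_is_zmod_morphism : zmod_morphism ev.
Proof. by move=> f g; rewrite feval.unlock raddfB. Qed.

HB.instance Definition _ :=
  GRing.isZmodMorphism.Build (freealg K I) A ev feval_is_zmod_morphism.

Lemma feval_is_monoid_morphism : monoid_morphism ev.
Proof.
have [|evM ev1] := @commr_mmap_is_multiplicative {fmonom I} K A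
  (in_alg A) (eval_word a); last by rewrite feval.unlock.
by move=> f w1 w2; rewrite /GRing.comm /= mulr_algl mulr_algr.
Qed.

HB.instance Definition _ :=
  GRing.isMonoidMorphism.Build (freealg K I) A ev feval_is_monoid_morphism.

Lemma feval_is_scalable : scalable ev.
Proof. by move=> c f; rewrite feval.unlock mmapZ /= mulr_algl. Qed.

HB.instance Definition _ :=
  GRing.isScalable.Build K (freealg K I) A *:%R ev feval_is_scalable.

Lemma feval_var i : ev (fvar K i) = a i.
Proof.
rewrite feval.unlock fvar.unlock mmapU /= scale1r mul1r /eval_word fmU.
by rewrite big_seq1.
Qed.

End EvaluationTheory.

Section Ideals.
Variable R : nzRingType.
Implicit Types (J : set R) (x y : R).

Record two_sided_ideal J : Prop := TwoSidedIdeal {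
  ideal0 : J 0;
  idealB : forall x y, J x -> J y -> J (x - y);
  idealMl : forall x y, J y -> J (x * y);
  idealMr : forall x y, J x -> J (x * y)
}.

Lemma idealN J : two_sided_ideal J -> forall x, J x -> J (- x).
Proof. by move=> idJ x Jx; rewrite -sub0r; apply: idealB (ideal0 idJ) Jx. Qed.

Lemma idealD J : two_sided_ideal J -> forall x y, J x -> J y -> J (x + y).
Proof.
by move=> idJ x y Jx Jy; rewrite -[y]opprK; apply/(idealB idJ Jx)/(idealN idJ).
Qed.

Definition ideal_gen (S : set R) : set R := smallest two_sided_ideal S.

Lemma ideal_gen_ideal S : two_sided_ideal (ideal_gen S).
Proof.
split=> [J [idJ _]|x y Jx Jy J JS|x y Jy J JS|x y Jx J JS].
- exact: ideal0.
- by case: (JS) => idJ _; apply: idealB (Jx J JS) (Jy J JS).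
- by case: (JS) => idJ _; apply: idealMl (Jy J JS).
- by case: (JS) => idJ _; apply: idealMr (Jx J JS).
Qed.

(* Properness makes the quotient a nonzero ring, as required of an algType. *)
Record proper_two_sided_ideal := ProperTwoSidedIdeal {
  ideal_set :> R -> Prop;
  ideal_setP : two_sided_ideal ideal_set;
  ideal_proper : ~ ideal_set 1
}.

End Ideals.

Section Quotient.
Variables (K : fieldType) (A : algType K) (J : proper_two_sided_ideal A).

Definition ideal_pred : {pred A} := fun x => `[< J x >].

Lemma ideal_predE x : (x \in ideal_pred) = `[< J x >]. Proof. by []. Qed.

Lemma ideal_pred_zmod : zmod_closed ideal_pred.
Proof.
split=> [|x y]; rewrite !ideal_predE.
  by apply/asboolP; exact: ideal0 (ideal_setP J).
by move=> /asboolP Jx /asboolP Jy; apply/asboolP; apply: idealB (ideal_setP J) _ _ Jx Jy.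
Qed.

HB.instance Definition _ := GRing.isZmodClosed.Build A ideal_pred
  ideal_pred_zmod.

Definition algquot := Quotient.quot (ideal_pred : zmodClosed A).

HB.instance Definition _ := EqQuotient.on algquot.
HB.instance Definition _ := GRing.Zmodule.on algquot.

Definition aqpi (x : A) : algquot := \pi x.

Lemma aqpiP x y : (aqpi x = aqpi y) <-> J (x - y).
Proof.
have -> : J (x - y) <-> x - y \in ideal_pred.
  by rewrite ideal_predE; split=> /asboolP.
by rewrite Quotient.idealrBE; split=> [h|/eqP //]; exact/eqP.
Qed.

Lemma aqpi_repr (u : algquot) : aqpi (repr u) = u. Proof. exact: reprK. Qed.

Lemma J_repr x : J (repr (aqpi x) - x).
Proof. by apply/aqpiP; rewrite aqpi_repr. Qed.

Lemma aqpiB : zmod_morphism aqpi.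
Proof.
move=> x y; rewrite /aqpi.
by rewrite (Quotient.pi_add (ideal_pred : zmodClosed A)) Quotient.pi_opp.
Qed.

HB.instance Definition _ := GRing.isZmodMorphism.Build A algquot aqpi aqpiB.

Definition aqone : algquot := aqpi 1.
Definition aqmul (u v : algquot) : algquot := aqpi (repr u * repr v).
Definition aqscale (c : K) (u : algquot) : algquot := aqpi (c *: repr u).

Lemma aqmulE x y : aqmul (aqpi x) (aqpi y) = aqpi (x * y).
Proof.
apply/aqpiP; have idJ := ideal_setP J.
rewrite -[X in X - _](subrK (repr (aqpi x) * y)) -mulrBr -addrA -mulrBl.
by apply: (idealD idJ);
  [apply: (idealMl idJ)|apply: (idealMr idJ)]; apply: J_repr.
Qed.

Lemma aqscaleE c x : aqscale c (aqpi x) = aqpi (c *: x).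
Proof.
apply/aqpiP; rewrite -scalerBr -mulr_algl.
by apply: (idealMl (ideal_setP J)); apply: J_repr.
Qed.

Lemma aq_ind (P : algquot -> Prop) : (forall x, P (aqpi x)) -> forall u, P u.
Proof. by move=> Ppi u; rewrite -(aqpi_repr u). Qed.

Lemma aqmulA : associative aqmul.
Proof.
by elim/aq_ind=> x; elim/aq_ind=> y; elim/aq_ind=> z; rewrite !aqmulE mulrA.
Qed.

Lemma aqmul1r : left_id aqone aqmul.
Proof. by elim/aq_ind=> x; rewrite aqmulE mul1r. Qed.

Lemma aqmulr1 : right_id aqone aqmul.
Proof. by elim/aq_ind=> x; rewrite aqmulE mulr1. Qed.

Lemma aqmulDl : left_distributive aqmul +%R.
Proof.
elim/aq_ind=> x; elim/aq_ind=> y; elim/aq_ind=> z.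
by rewrite -raddfD !aqmulE mulrDl raddfD.
Qed.

Lemma aqmulDr : right_distributive aqmul +%R.
Proof.
elim/aq_ind=> x; elim/aq_ind=> y; elim/aq_ind=> z.
by rewrite -raddfD !aqmulE mulrDr raddfD.
Qed.

Lemma aqone_neq0 : aqone != 0.
Proof.
apply/eqP; rewrite -(raddf0 aqpi) => /aqpiP; rewrite subr0.
exact: ideal_proper.
Qed.

HB.instance Definition _ := GRing.Zmodule_isNzRing.Build algquot
  aqmulA aqmul1r aqmulr1 aqmulDl aqmulDr aqone_neq0.

Lemma aqscalerA c d u : aqscale c (aqscale d u) = aqscale (c * d) u.
Proof. by elim/aq_ind: u => x; rewrite !aqscaleE scalerA. Qed.

Lemma aqscale1r : left_id 1 aqscale.
Proof. by elim/aq_ind=> x; rewrite aqscaleE scale1r. Qed.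

Lemma aqscalerDr : right_distributive aqscale +%R.
Proof.
move=> c; elim/aq_ind=> x; elim/aq_ind=> y.
by rewrite -raddfD !aqscaleE scalerDr raddfD.
Qed.

Lemma aqscalerDl u : {morph aqscale^~ u : c d / c + d}.
Proof. by elim/aq_ind: u => x c d; rewrite !aqscaleE scalerDl raddfD. Qed.

HB.instance Definition _ := GRing.Zmodule_isLmodule.Build K algquot
  aqscalerA aqscale1r aqscalerDr aqscalerDl.

Lemma aqscalerAl (c : K) (u v : algquot) : c *: (u * v) = (c *: u) * v.
Proof.
elim/aq_ind: u => x; elim/aq_ind: v => y.
by rewrite /GRing.scale /GRing.mul /= !(aqscaleE, aqmulE) scalerAl.
Qed.

HB.instance Definition _ := GRing.Lmodule_isLalgebra.Build K algquot aqscalerAl.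

Lemma aqscalerAr (c : K) (u v : algquot) : c *: (u * v) = u * (c *: v).
Proof.
elim/aq_ind: u => x; elim/aq_ind: v => y.
by rewrite /GRing.scale /GRing.mul /= !(aqscaleE, aqmulE) scalerAr.
Qed.

HB.instance Definition _ := GRing.Lalgebra_isAlgebra.Build K algquot aqscalerAr.

Lemma aqpi_monoid_morphism : monoid_morphism aqpi.
Proof. by split=> // x y; rewrite /GRing.mul /= aqmulE. Qed.

HB.instance Definition _ :=
  GRing.isMonoidMorphism.Build A algquot aqpi aqpi_monoid_morphism.

Lemma aqpi_scalable : scalable aqpi.
Proof. by move=> c x; rewrite {2}/GRing.scale /= aqscaleE. Qed.

HB.instance Definition _ :=
  GRing.isScalable.Build K A algquot *:%R aqpi aqpi_scalable.

End Quotient.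

Section PolynomialIdentities.
Variable K : fieldType.

(* K<X> on a countably infinite alphabet, numbered from 0: the variable written
   x_1 in the usual notation is [fvar K 0]. *)
Local Notation KX := (freealg K nat).

Definition Id (A : algType K) : set KX :=
  [set f | forall a : nat -> A, feval a f = 0].

Record T_ideal (J : set KX) : Prop := TIdeal {
  T_ideal_ideal : two_sided_ideal J;
  T_ideal_endo : forall (phi : {lrmorphism KX -> KX}) f, J f -> J (phi f)
}.

Definition T_ideal_gen (S : set KX) : set KX := smallest T_ideal S.

End PolynomialIdentities.

Section Commutators.
Variable R : nzRingType.

Definition comm2 (a b : R) : R := a * b - b * a.

(* [a_1, ..., a_m] = [[a_1, ..., a_(m-1)], a_m]; the empty sequence, for which
   no commutator exists, gets the dummy value 0. *)
Definition lncomm (s : seq R) : R :=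
  if s is a :: s' then foldl comm2 a s' else 0.

Definition standard_poly (m : nat) (a : 'I_m -> R) : R :=
  \sum_(s : 'S_m) (-1) ^+ s * \prod_(i < m) a (s i).

End Commutators.

Lemma rmorph_comm2 (R S : nzRingType) (f : {rmorphism R -> S}) a b :
  f (comm2 a b) = comm2 (f a) (f b).
Proof. by rewrite /comm2 rmorphB !rmorphM. Qed.

Lemma rmorph_lncomm (R S : nzRingType) (f : {rmorphism R -> S}) (s : seq R) :
  f (lncomm s) = lncomm (map f s).
Proof.
case: s => [|a s] /=; first exact: rmorph0.
by elim: s a => //= b s IHs a; rewrite IHs rmorph_comm2.
Qed.

Lemma rmorph_standard_poly (R S : nzRingType) (f : {rmorphism R -> S}) m
  (a : 'I_m -> R) :
  f (standard_poly a) = standard_poly (fun i => f (a i)).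
Proof.
rewrite rmorph_sum; apply: eq_bigr => s _.
by rewrite rmorphM rmorph_sign rmorph_prod.
Qed.

Section RelativelyFree.
Variable K : fieldType.
Local Notation KX := (freealg K nat).

(* I_p, for p >= 2. *)
Definition commutator_ideal (p : nat) : set KX :=
  ideal_gen [set lncomm u | u in [set: p.-tuple KX]].

(* The inclusion of K<x_1, ..., x_n>, realised as the free algebra on 'I_n, into
   K<X>. *)
Definition freealg_incl (n : nat) : freealg K 'I_n -> KX :=
  feval (fun i : 'I_n => fvar K (i : nat)).

HB.instance Definition _ n := GRing.LRMorphism.on (@freealg_incl n).

Lemma commutator_ideal_proper p : ~ commutator_ideal p.+2 1.
Proof.
have eps : {lrmorphism KX -> K^o} := feval (fun=> 0 : K^o).
have epsB f g : eps (f - g) = eps f - eps g by exact: raddfB.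
have epsM f g : eps (f * g) = eps f * eps g by exact: rmorphM.
pose ker : set KX := [set f | eps f = 0].
have kerP : two_sided_ideal ker.
  rewrite /ker; split=> [|f g /= f0 g0|f g /= g0|f g /= f0].
  - exact: raddf0.
  - by rewrite epsB f0 g0 subrr.
  - by rewrite epsM g0 mulr0.
  - by rewrite epsM f0 mul0r.
have ker_comm2 (f g : KX) : ker (comm2 f g).
  by rewrite /ker /comm2 /= epsB !epsM mulrC subrr.
have kerS : [set lncomm u | u in [set: p.+2.-tuple KX]] `<=` ker.
  move=> _ [[[//|a [//|b s]] _] _ <-] /=.
  by elim/last_ind: s => [|s c _]; rewrite /= ?foldl_rcons; apply: ker_comm2.
move=> /(_ ker (conj kerP kerS)); rewrite /ker /= (rmorph1 eps) => /eqP.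
by rewrite oner_eq0.
Qed.

Section Quot.
Variables (n p : nat) (p_gt0 : (0 < p)%N).

(* The intersection of I_(p+1) with K<x_1, ..., x_n>: its preimage under the
   inclusion, I_(p+1) being the ideal generated in the whole of K<X>. *)
Definition relfree_ideal_set : set (freealg K 'I_n) :=
  @freealg_incl n @^-1` commutator_ideal p.+1.

Lemma relfree_ideal_subproof : two_sided_ideal relfree_ideal_set.
Proof.
have idI := ideal_gen_ideal [set lncomm u | u in [set: p.+1.-tuple KX]].
split=> [|f g|f g|f g]; rewrite /relfree_ideal_set /= ?raddf0 ?raddfB ?rmorphM.
- exact: ideal0.
- exact: idealB.
- exact: idealMl.
- exact: idealMr.
Qed.

Lemma relfree_ideal_proper : ~ relfree_ideal_set 1.
Proof.
rewrite /relfree_ideal_set /= rmorph1; case: p p_gt0 => // q _.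
exact: commutator_ideal_proper.
Qed.

Definition relfree_ideal : proper_two_sided_ideal (freealg K 'I_n) :=
  ProperTwoSidedIdeal relfree_ideal_subproof relfree_ideal_proper.

(* F_n(N_p), the relatively free algebra of rank n in the variety of algebras
   satisfying [x_1, ..., x_(p+1)] = 0, where p >= 1. *)
Definition relfree : algType K := algquot relfree_ideal.

End Quot.
End RelativelyFree.

Arguments relfree : clear implicits.

(* Main.v *)
Require Import Defs.
From Stdlib Require Ncring Ncring_tac.
From mathcomp Require Import all_boot all_algebra perm.
From mathcomp Require Import finmap boolp classical_sets ring.
From mathcomp.multinomials Require Import monalg.

(** Write T for the T-ideal generated by [x1, x2, x3, x4] and s_4.  The theorem
    follows from the inclusions Id(F_2) <= T <= Id(F_3) <= Id(F_2); the last one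
    only says that an identity in more generators is an identity in fewer.

    T <= Id(F_3).  In a ring where all commutators of length four vanish, the
    product of a commutator of length three and a commutator is zero
    ([triple_pair0]): it is skew-symmetric in its five arguments, so by the
    Jacobi identity three times the product is zero.  Moreover commutators
    commute with each other, so s_4(a, b, c, d) is twice
      [a, b][c, d] - [a, c][b, d] + [a, d][b, c].
    This expression is alternating and, by the vanishing of the products above, a
    derivation in each argument.  It vanishes as soon as it does on generators,
    and among four elements of a set of three generators two coincide.

    Id(F_2) <= T.  Modulo T products of three commutators vanish as well, so
    modulo T there are only four layers of terms: words w, then w [x_i, x_j],
    then w [x_i, x_j, x_k], then w [x_i, x_j] [x_k, x_l].  In the last two
    layers the order of the letters of w is immaterial; in the first two,
    reordering w costs terms of later layers.  An f in Id(F_2) is a combination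
    of words, and it is pushed from each layer into the next one.  To this end
    f is evaluated at x_i |-> c_i + s_i p + t_i q, with scalars c_i, s_i, t_i
    and p, q in an algebra B with two generators u and v such that z = [u, v] is
    central, z^2 is nonzero and z^2 u = z^2 v = 0.  Then z^3 = 0, which makes B
    satisfy [x1, x2, x3, x4] = 0 ([heis_commutator_ideal]).  Commutators
    become multiples of the minors D_ij = s_i t_j - s_j t_i, and the coefficient
    of z^2 isolates one layer at a time:
    - words: multiply by z^2;
    - w [x_i, x_j]: take p = u, q = v and multiply by z;
    - w [x_i, x_j, x_k]: take p = u, q = v^2, for which [p, q, p] = - 2 z^2
      whereas [p, q, q] and [p, q]^2 vanish;
    - w [x_i, x_j] [x_k, x_l]: take p = u, q = v.
    In each case a polynomial in c, s, t with coefficients read off from f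
    vanishes as a function, hence is killed by every linear map defined on
    monomials ([vanishing_poly_apply3]).  The maps
      s_i t_j |-> [x_i, x_j],
      s_i s_k t_j |-> [x_i, x_j, x_k] + [x_k, x_j, x_i],
      s_i s_k t_j t_l |-> [x_i, x_j] [x_k, x_l] + [x_i, x_l] [x_k, x_j]
    send D_ij, D_ij s_k and D_ij D_kl to 2, 3 and 6 times the corresponding
    product of commutators, by the Jacobi identity for the second and by s_4 = 0
    for the third.  Dividing by these numbers shows that the layer is a
    combination of later ones; after the last layer f lies in T. *)

Set Implicit Arguments.
Unset Strict Implicit.
Unset Printing Implicit Defensive.

Import GRing.Theory.
Local Open Scope ring_scope.
Local Open Scope classical_set_scope.

Local Notation "⟦ a , b ⟧" := (comm2 a b).
Local Notation "⟦ a , b , c ⟧" := (comm2 (comm2 a b) c).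

(** * Commutators in rings without commutators of length four *)

Section NoncommutativeRing.
Import Ncring Ncring_tac.
Local Open Scope ring_scope.
Variable R : nzRingType.

Local Instance nzring_ops : @Ring_ops R 0 1 (@GRing.add R) (@GRing.mul R)
  (fun x y => x - y) (@GRing.opp R) (@eq R) := {}.

Local Instance nzring_ring : Ring (Ro := nzring_ops).
Proof.
constructor; try exact _; try (by move=> x y -> a b ->); try (by move=> x y ->).
- exact: add0r.
- exact: addrC.
- exact: addrA.
- exact: mul1r.
- exact: mulr1.
- exact: mulrA.
- exact: mulrDl.
- by move=> x y z; exact: mulrDr.
- by [].
- exact: subrr.
Qed.

Ltac ncring :=
  rewrite /comm2 ?mulr2n ?mulrSr ?mulr0n ?add0r /=; non_commutative_ring.

Implicit Types a b c d e : R.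

Lemma comm2_antisym a b : ⟦a, b⟧ = - ⟦b, a⟧.
Proof. ncring. Qed.

Lemma comm2_Ml a b c : ⟦a * b, c⟧ = a * ⟦b, c⟧ + ⟦a, c⟧ * b.
Proof. ncring. Qed.

Lemma comm2_Mr a b c : ⟦a, b * c⟧ = b * ⟦a, c⟧ + ⟦a, b⟧ * c.
Proof. ncring. Qed.

Lemma comm2_jacobi a b c : ⟦a, b, c⟧ + ⟦b, c, a⟧ + ⟦c, a, b⟧ = 0.
Proof. ncring. Qed.

(** The left-hand side is the image of (s_a t_b - s_b t_a) s_c under the map
    s_i s_k t_j |-> [i, j, k] + [k, j, i]. *)
Lemma triple_symmetrization a b c :
  ⟦a, b, c⟧ + ⟦c, b, a⟧ - (⟦b, a, c⟧ + ⟦c, a, b⟧) = ⟦a, b, c⟧ *+ 3.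
Proof. ncring. Qed.

Lemma comm2_eq0 a b : ⟦a, b⟧ = 0 -> a * b = b * a.
Proof. exact: subr0_eq. Qed.

Section LieNilpotent.
Hypothesis nil3 : forall a b c d, ⟦⟦a, b, c⟧, d⟧ = 0.
Hypothesis tf3 : forall x : R, x *+ 3 = 0 -> x = 0.

Lemma triple_central a b c x : ⟦a, b, c⟧ * x = x * ⟦a, b, c⟧.
Proof. exact: comm2_eq0. Qed.

(** The Leibniz rule for the vanishing [a, b, c d, e]. *)
Lemma triple_pair_swap a b c d e :
  ⟦a, b, c⟧ * ⟦d, e⟧ = - (⟦a, b, d⟧ * ⟦c, e⟧).
Proof.
apply/eqP; rewrite -addr_eq0; apply/eqP.
have := nil3 a b (c * d) e.
have -> : ⟦⟦a, b, c * d⟧, e⟧ = ⟦c, e⟧ * ⟦a, b, d⟧ + c * ⟦⟦a, b, d⟧, e⟧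
    + ⟦⟦a, b, c⟧, e⟧ * d + ⟦a, b, c⟧ * ⟦d, e⟧ by ncring.
by rewrite !nil3 mulr0 mul0r !addr0 -triple_central addrC.
Qed.

Lemma triple_pair_swap' a b c d e :
  ⟦a, b, c⟧ * ⟦d, e⟧ = - (⟦a, b, e⟧ * ⟦d, c⟧).
Proof.
by rewrite (comm2_antisym d e) mulrN (triple_pair_swap a b c e d) opprK
  (comm2_antisym c d) mulrN.
Qed.

(** The Leibniz rule for the vanishing [d a, e, b, c]: of the six products of a
    triple and a pair in its expansion, four cancel by skew-symmetry in the last
    three arguments. *)
Lemma triple_pair_swap1 a b c d e :
  ⟦a, b, c⟧ * ⟦d, e⟧ = - (⟦d, b, c⟧ * ⟦a, e⟧).
Proof.
have := nil3 (d * a) e b c.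
have -> : ⟦⟦d * a, e, b⟧, c⟧ =
    (⟦d, e, b⟧ * ⟦a, c⟧ + ⟦d, e, c⟧ * ⟦a, b⟧)
    + (⟦d, c⟧ * ⟦a, e, b⟧ + ⟦d, b⟧ * ⟦a, e, c⟧)
    + (⟦a, b, c⟧ * ⟦d, e⟧ + ⟦d, b, c⟧ * ⟦a, e⟧)
    + (d * ⟦⟦a, e, b⟧, c⟧ + ⟦⟦d, e, b⟧, c⟧ * a
       + (⟦d, e⟧ * ⟦a, b, c⟧ - ⟦a, b, c⟧ * ⟦d, e⟧)) by ncring.
rewrite !nil3 mulr0 mul0r !triple_central subrr !addr0 -!triple_central.
rewrite [X in X + _ + _ = _ -> _](_ : _ = 0); last first.
  by rewrite triple_pair_swap' addNr.
rewrite [X in _ + X + _ = _ -> _](_ : _ = 0); last first.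
  by rewrite triple_pair_swap' addNr.
by rewrite !add0r => /eqP; rewrite addr_eq0 => /eqP.
Qed.

(** The transpositions above generate the permutations of the five arguments, so
    the product is invariant under cyclic permutations of a, b, c, and the Jacobi
    identity makes three times the product vanish. *)
Lemma triple_pair0 a b c d e : ⟦a, b, c⟧ * ⟦d, e⟧ = 0.
Proof.
have cyc x y z : ⟦x, y, z⟧ * ⟦d, e⟧ = ⟦y, z, x⟧ * ⟦d, e⟧.
  rewrite triple_pair_swap triple_pair_swap1.
  by rewrite triple_pair_swap [⟦z, y⟧]comm2_antisym; ncring.
apply: tf3; rewrite !mulrS mulr0n addr0.
by rewrite {3}(cyc a b c) (cyc b c a) {2}(cyc a b c) -!mulrDl addrA
  comm2_jacobi mul0r.
Qed.

Lemma pair_triple0 a b c d e : ⟦d, e⟧ * ⟦a, b, c⟧ = 0.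
Proof. by rewrite -triple_central triple_pair0. Qed.

Lemma pair_comm a b c d : ⟦a, b⟧ * ⟦c, d⟧ = ⟦c, d⟧ * ⟦a, b⟧.
Proof.
apply: comm2_eq0.
have -> : ⟦⟦a, b⟧, ⟦c, d⟧⟧ = ⟦⟦a, b, c⟧, d⟧ - ⟦⟦a, b, d⟧, c⟧ by ncring.
by rewrite !nil3 subr0.
Qed.

Lemma pair_absorb x a b c d : ⟦a, b⟧ * (x * ⟦c, d⟧) = x * (⟦a, b⟧ * ⟦c, d⟧).
Proof.
apply/eqP; rewrite -subr_eq0; apply/eqP.
rewrite -[RHS](triple_pair0 a b x c d); ncring.
Qed.

Lemma pair_pair_central a b c d x :
  ⟦a, b⟧ * ⟦c, d⟧ * x = x * (⟦a, b⟧ * ⟦c, d⟧).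
Proof.
apply: comm2_eq0.
have -> : ⟦⟦a, b⟧ * ⟦c, d⟧, x⟧ = ⟦a, b⟧ * ⟦c, d, x⟧ + ⟦a, b, x⟧ * ⟦c, d⟧
  by ncring.
by rewrite pair_triple0 triple_pair0 addr0.
Qed.

(** The Pfaffian of the skew-symmetric 4 x 4 matrix of commutators. *)
Definition pfaff4 a b c d : R :=
  ⟦a, b⟧ * ⟦c, d⟧ - ⟦a, c⟧ * ⟦b, d⟧ + ⟦a, d⟧ * ⟦b, c⟧.

Lemma pfaff4_swap12 a b c d : pfaff4 b a c d = - pfaff4 a b c d.
Proof.
rewrite /pfaff4 [⟦b, c⟧ * _]pair_comm [⟦b, d⟧ * _]pair_comm; ncring.
Qed.

Lemma pfaff4_swap23 a b c d : pfaff4 a c b d = - pfaff4 a b c d.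
Proof. by rewrite /pfaff4; ncring. Qed.

Lemma pfaff4_swap34 a b c d : pfaff4 a b d c = - pfaff4 a b c d.
Proof. by rewrite /pfaff4; ncring. Qed.

Lemma pfaff4_diag a c d : pfaff4 a a c d = 0.
Proof. by rewrite /pfaff4 [X in _ + X]pair_comm; ncring. Qed.

(** The Leibniz rule, without regard for the side on which the coefficients stand:
    moving them across costs a product of a triple and a pair. *)
Lemma pfaff4_M x y b c d :
  pfaff4 (x * y) b c d = x * pfaff4 y b c d + y * pfaff4 x b c d.
Proof.
apply/eqP; rewrite -subr_eq0; apply/eqP.
transitivity (⟦x, b, y⟧ * ⟦c, d⟧ - ⟦x, c, y⟧ * ⟦b, d⟧ + ⟦x, d, y⟧ * ⟦b, c⟧).
  by rewrite /pfaff4; ncring.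
by rewrite !triple_pair0 subr0 addr0.
Qed.

(** The Leibniz rule for [a c, b, d], multiplied by [e, f]: only the two products
    of commutators survive. *)
Lemma pair_pair_pair_swap a b c d e f :
  ⟦a, b⟧ * ⟦c, d⟧ * ⟦e, f⟧ = - (⟦a, d⟧ * ⟦c, b⟧ * ⟦e, f⟧).
Proof.
apply/eqP; rewrite -addr_eq0; apply/eqP.
transitivity (⟦a * c, b, d⟧ * ⟦e, f⟧ - a * (⟦c, b, d⟧ * ⟦e, f⟧)
   - ⟦a, b, d⟧ * c * ⟦e, f⟧); first by ncring.
by rewrite !triple_pair0 triple_central -mulrA triple_pair0 !mulr0 !subr0.
Qed.

Section Pfaffian.
Hypothesis pfaff0 : forall a b c d, pfaff4 a b c d = 0.

(** The swap makes the three terms of the Pfaffian, multiplied by [e, f], equal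
    to each other. *)
Lemma pair_pair_pair0 a b c d e f : ⟦a, b⟧ * ⟦c, d⟧ * ⟦e, f⟧ = 0.
Proof.
apply: tf3; rewrite !mulrS mulr0n addr0.
have := congr1 (fun y => y * ⟦e, f⟧) (pfaff0 a b c d).
rewrite /pfaff4 mul0r mulrDl mulrBl (pair_pair_pair_swap a c b d).
have -> : ⟦a, d⟧ * ⟦b, c⟧ * ⟦e, f⟧ = ⟦a, b⟧ * ⟦c, d⟧ * ⟦e, f⟧.
  by rewrite [RHS]pair_pair_pair_swap (comm2_antisym b c) mulrN mulNr.
by rewrite opprK addrA.
Qed.

(** The image of the monomial s_a s_b t_c t_d. *)
Definition sym_pairs a b c d : R := ⟦a, c⟧ * ⟦b, d⟧ + ⟦a, d⟧ * ⟦b, c⟧.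

Lemma sym_pairsCl a b c d : sym_pairs b a c d = sym_pairs a b c d.
Proof. by rewrite /sym_pairs addrC ![⟦b, _⟧ * _]pair_comm. Qed.

Lemma sym_pairsCr a b c d : sym_pairs a b d c = sym_pairs a b c d.
Proof. exact: addrC. Qed.

(** The left-hand side is the image of the product of minors
    (s_a t_b - s_b t_a) (s_c t_d - s_d t_c).  For commuting pairs the sum is
    6 [a, b] [c, d] minus twice the Pfaffian. *)
Lemma pair_pair_symmetrization a b c d :
  sym_pairs a c b d +
    (- sym_pairs a d b c + (- sym_pairs b c a d + sym_pairs b d a c)) =
  ⟦a, b⟧ * ⟦c, d⟧ *+ 6.
Proof.
rewrite /sym_pairs (pair_comm b c d a) (pair_comm b d c a).
rewrite -[RHS]subr0 -(mul0rn _ 2) -(pfaff0 a b c d) /pfaff4.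
ncring.
Qed.
End Pfaffian.
End LieNilpotent.

(** * The standard polynomial of degree four *)

(** Noncommutative analogue of the expansion of a determinant along its first
    row; [lift_perm ord0 j s] is the permutation with value j at 0 and the
    pattern s elsewhere. *)
Lemma standard_poly_expand n (a : 'I_n.+1 -> R) :
  standard_poly a =
  \sum_(j < n.+1) (-1) ^+ j * (a j * standard_poly (fun i => a (lift j i))).
Proof.
pose h (p : 'I_n.+1 * 'S_n) := lift_perm ord0 p.1 p.2.
have h_bij : bijective h.
  apply: inj_card_bij; last by rewrite card_prod !card_ord !card_Sn factS.
  move=> [j s] [k t] /permP eq_h.
  have eq_jk : j = k by have := eq_h ord0; rewrite !lift_perm_id.
  congr (_, _) => //; apply/permP=> i; apply: (@lift_inj _ k).
  by have := eq_h (lift ord0 i); rewrite !lift_perm_lift /= eq_jk.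
rewrite /standard_poly (reindex h) /=; last exact: onW_bij.
rewrite -(pair_bigA _ (fun j s => (-1) ^+ h (j, s) *
  \prod_(i < n.+1) a (h (j, s) i))) /=.
apply: eq_bigr => j _; rewrite !mulr_sumr; apply: eq_bigr => s _.
rewrite big_ord_recl lift_perm_id odd_lift_perm /= signr_addb signr_odd.
rewrite -mulrA; congr (_ * _); rewrite [RHS]mulrA commr_sign -mulrA.
by congr (_ * (_ * _)); apply: eq_bigr => i _; rewrite lift_perm_lift.
Qed.

Lemma standard_poly0 (a : 'I_0 -> R) : standard_poly a = 1.
Proof.
rewrite /standard_poly (big_pred1 (1%g : 'S_0)) => [|s].
  by rewrite odd_perm1 big_ord0 mulr1.
by apply/esym/eqP/permP => -[].
Qed.

Lemma standard_poly4 (nil3 : forall a b c d, ⟦⟦a, b, c⟧, d⟧ = 0)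
    (a : nat -> R) :
  standard_poly (fun i : 'I_4 => a i) = pfaff4 (a 0) (a 1) (a 2) (a 3) *+ 2.
Proof.
transitivity (pfaff4 (a 0) (a 1) (a 2) (a 3)
   + (⟦a 2, a 3⟧ * ⟦a 0, a 1⟧ - ⟦a 1, a 3⟧ * ⟦a 0, a 2⟧
      + ⟦a 1, a 2⟧ * ⟦a 0, a 3⟧)); last first.
  by rewrite mulr2n; congr (_ + _); rewrite /pfaff4;
    congr (_ - _ + _); apply: pair_comm.
(* The twenty-four words of s_4, grouped into products of two commutators. *)
rewrite !(standard_poly_expand, big_ord_recl, big_ord0, standard_poly0) /=.
rewrite /bump /= !(addn0, add0n, addnS) !(expr0, expr1, expr2, exprS) /pfaff4.
ncring.
Qed.
End NoncommutativeRing.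

(** * Reordering words *)

Section Words.
Variables (R : nzRingType) (x : nat -> R).

Definition word (w : seq nat) : R := \prod_(i <- w) x i.

Lemma word_cat w1 w2 : word (w1 ++ w2) = word w1 * word w2.
Proof. exact: big_cat. Qed.

Lemma word_rcons w i : word (rcons w i) = word w * x i.
Proof. exact: big_rcons. Qed.

Lemma word_cons i w : word (i :: w) = x i * word w.
Proof. exact: big_cons. Qed.

(** Moving one letter x_i to the front of a word changes it by a commutator
    [v, x_i] w, so reordering a word in front of P costs nothing modulo any S
    which contains these commutators times P and is stable under sums and left
    multiplication by letters. *)
Lemma word_perm_mod (S : R -> Prop) (P : R) :
    S 0 -> (forall y z, S y -> S z -> S (y + z)) ->
    (forall i y, S y -> S (x i * y)) ->
    (forall v i w, S (comm2 (word v) (x i) * (word w * P))) ->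
  forall w w', perm_eq w w' -> S (word w' * P - word w * P).
Proof.
move=> S0 SD SM Scomm; elim=> [|i w IHw] w'.
  by rewrite perm_sym => /perm_nilP ->; rewrite subrr.
move=> eq_w; have i_w' : i \in w' by rewrite -(perm_mem eq_w) mem_head.
have [w1 [w2 def_w']] : exists w1 w2, w' = w1 ++ i :: w2.
  by case/splitPr: i_w' => w1 w2; exists w1, w2.
have {}eq_w : perm_eq w (w1 ++ w2).
  by rewrite -(perm_cons i) (permPl eq_w) def_w' -cat1s perm_catCA.
have -> : word w' * P - word (i :: w) * P =
    x i * (word (w1 ++ w2) * P - word w * P)
    + comm2 (word w1) (x i) * (word w2 * P).
  rewrite def_w' !word_cat !word_cons /comm2 mulrBr mulrBl !mulrA.
  by rewrite [RHS]addrC addrA subrK.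
apply: SD (Scomm _ _ _); exact/SM/IHw.
Qed.

End Words.

(** * Polynomials vanishing as functions *)

Section VanishingPolynomials.
Variables (K : fieldType) (charK0 : [pchar K] =i pred0).

Lemma natr_inj_char0 : injective (fun n => n%:R : K).
Proof.
move=> m n /= eq_mn; wlog le_mn : m n eq_mn / (m <= n)%N.
  by move=> IH; case/orP: (leq_total m n) => /IH-> //.
have /eqP := subrr (n%:R : K); rewrite -{2}eq_mn -natrB //.
have /pcharf0P -> := charK0; rewrite subn_eq0 => le_nm.
by apply/eqP; rewrite eqn_leq le_mn.
Qed.

Lemma poly_vanish (p : {poly K}) : (forall a, p.[a] = 0) -> p = 0.
Proof.
move=> p0; apply: (@roots_geq_poly_eq0 _ p [seq i%:R | i <- iota 0 (size p)]).
- by apply/allP=> a _; apply/rootP.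
- by rewrite map_inj_uniq ?iota_uniq //; apply: natr_inj_char0.
- by rewrite size_map size_iota.
Qed.

Section Monomials.
Variables (I : eqType) (V : lmodType K).

Lemma prod_extract_letter (i : I) (a : K) (y : I -> K) (w : seq I) :
  \prod_(j <- w) (if j == i then a else y j) =
  a ^+ count_mem i w * \prod_(j <- [seq j <- w | j != i]) y j.
Proof.
rewrite (bigID (pred1 i)) /= big_filter; congr (_ * _); last first.
  by apply: eq_bigr => j /negPf->.
rewrite -big_filter (@all_pred1P _ i _ (filter_all _ _)) size_filter.
by rewrite big_nseq eqxx iter_mulr_1.
Qed.

Lemma perm_extract_letter (i : I) (w : seq I) :
  perm_eq (nseq (count_mem i w) i ++ [seq j <- w | j != i]) w.
Proof.
by rewrite -size_filter -(@all_pred1P _ i _ (filter_all _ _)) perm_filterC.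
Qed.

(** The polynomial is the list L of its terms, where a monomial is a word and
    several terms may represent the same monomial.  Over an infinite field a
    polynomial which vanishes as a function has only zero coefficients, hence it
    is killed by every map defined on monomials.  The induction is on the list of
    letters: the coefficient of each power of the first letter is a polynomial
    in the other letters which vanishes as a function. *)
Lemma vanishing_poly_apply (L : seq (K * seq I)) (Phi : seq I -> V) :
    (forall y : I -> K, \sum_(p <- L) p.1 * \prod_(i <- p.2) y i = 0) ->
    (forall w w', perm_eq w w' -> Phi w = Phi w') ->
  \sum_(p <- L) p.1 *: Phi p.2 = 0.
Proof.
have [vs Lvs] : exists vs : seq I, all (fun p => all (mem vs) p.2) L.
  exists (flatten [seq p.2 | p <- L]); apply/allP=> p pL; apply/allP=> i ip /=.
  by apply/flattenP; exists p.2 => //; apply: map_f.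
elim: vs L Phi Lvs => [|i vs IHvs] L Phi Lvs L0 PhiP.
  have Lnil p : p \in L -> p.2 = [::] by move=> /(allP Lvs); case: p.2.
  transitivity ((\sum_(p <- L) p.1) *: Phi [::]).
    by rewrite scaler_suml; apply: eq_big_seq => p /Lnil ->.
  rewrite [X in X *: _](_ : _ = 0) ?scale0r // -[RHS](L0 (fun=> 0)).
  by apply: eq_big_seq => p /Lnil ->; rewrite big_nil mulr1.
pose N := \max_(p <- L) count_mem i p.2.
have leN p : p \in L -> (count_mem i p.2 <= N)%N.
  by move=> pL; apply: (@leq_bigmax_seq _ L xpredT (fun p => count_mem i p.2)).
(* The coefficient of the d-th power of the letter i. *)
pose reduced d := [seq (p.1, [seq j <- p.2 | j != i]) |
                   p <- L & count_mem i p.2 == d].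
transitivity (\sum_(p <- L) \sum_(d < N.+1)
    if count_mem i p.2 == d then p.1 *: Phi p.2 else 0).
  apply: eq_big_seq => p /leN; rewrite -ltnS => lt_pN.
  by rewrite -big_mkcond (big_pred1 (Ordinal lt_pN)).
rewrite exchange_big big1 // => d _; rewrite -big_mkcond.
transitivity (\sum_(p <- reduced d) p.1 *: Phi (nseq d i ++ p.2)).
  rewrite big_map big_filter; apply: eq_bigr => p /eqP <-.
  by congr (_ *: _); apply: PhiP; rewrite perm_sym perm_extract_letter.
apply: (IHvs _ (fun w => Phi (nseq d i ++ w))).
- apply/allP=> q /mapP[p]; rewrite mem_filter => /andP[_ /(allP Lvs) pvs] ->.
  apply/allP=> j /=; rewrite mem_filter => /andP[/negPf ji jp].
  by have : j \in i :: vs := allP pvs j jp; rewrite in_cons ji.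
- move=> y; rewrite big_map big_filter.
  pose P : {poly K} := \sum_(p <- L)
    (p.1 * \prod_(j <- [seq j <- p.2 | j != i]) y j) *: 'X^(count_mem i p.2).
  have /(congr1 (fun P : {poly K} => P`_d)) : P = 0.
    apply: poly_vanish => a.
    rewrite -[RHS](L0 (fun j => if j == i then a else y j)).
    rewrite horner_sum; apply: eq_bigr => p _.
    by rewrite hornerZ hornerXn prod_extract_letter -mulrA [X in _ * X]mulrC.
  rewrite coef0 coef_sum => P0; rewrite -[RHS]P0 big_mkcond /=.
  apply: eq_bigr => p _; rewrite coefZ coefXn eq_sym.
  by case: eqP; rewrite ?mulr1 ?mulr0.
- by move=> w w' eq_w; apply: PhiP; rewrite perm_cat2l.
Qed.

End Monomials.

Definition mono (y : nat -> K) (w : seq nat) : K := \prod_(i <- w) y i.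

Lemma mono1 y i : mono y [:: i] = y i. Proof. exact: big_seq1. Qed.

Lemma mono2 y i j : mono y [:: i; j] = y i * y j.
Proof. by rewrite /mono big_cons big_seq1. Qed.

(** Three families of variables, coded by letters (0, i), (1, i), (2, i).  Sorting
    the three parts of a monomial makes any Psi a function of the monomial. *)
Lemma vanishing_poly_apply3 (V : lmodType K)
    (L : seq (K * (seq nat * seq nat * seq nat)))
    (Psi : seq nat -> seq nat -> seq nat -> V) :
    (forall c s t : nat -> K, \sum_(p <- L)
       p.1 * (mono c p.2.1.1 * mono s p.2.1.2 * mono t p.2.2) = 0) ->
  \sum_(p <- L) p.1 *:
     Psi (sort leq p.2.1.1) (sort leq p.2.1.2) (sort leq p.2.2) = 0.
Proof.
move=> L0; pose enc (m : seq nat * seq nat * seq nat) : seq (nat * nat) :=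
  map (pair 0) m.1.1 ++ map (pair 1) m.1.2 ++ map (pair 2) m.2.
pose sel (k : nat) (w : seq (nat * nat)) := [seq q.2 | q <- w & q.1 == k].
have selE k j w : sel k (map (pair j) w) = if j == k then w else [::].
  rewrite /sel; elim: w => [|i w IHw] /=; first by case: ifP.
  by case: ifP IHw => // _ IHw; rewrite map_cons IHw.
have sel_enc m : (sel 0 (enc m) = m.1.1) * (sel 1 (enc m) = m.1.2) *
    (sel 2 (enc m) = m.2).
  by rewrite /sel /enc !filter_cat !map_cat -!/(sel _ _) !selE /= ?cats0.
pose Phi w := Psi (sort leq (sel 0 w)) (sort leq (sel 1 w)) (sort leq (sel 2 w)).
transitivity (\sum_(p <- [seq (p.1, enc p.2) | p <- L]) p.1 *: Phi p.2).
  by rewrite big_map; apply: eq_bigr => p _; rewrite /Phi !sel_enc.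
apply: vanishing_poly_apply => [y|w w' eq_w].
  rewrite big_map -[RHS](L0 (fun i => y (0, i)) (fun i => y (1, i))
    (fun i => y (2, i))); apply: eq_bigr => p _.
  by congr (_ * _); rewrite /mono /enc !big_cat !big_map /= mulrA.
have sel_w k : sort leq (sel k w) = sort leq (sel k w').
  apply/(perm_sortP leq_total leq_trans anti_leq).
  exact/perm_map/perm_filter.
by rewrite /Phi !sel_w.
Qed.
End VanishingPolynomials.

(** * Free algebras and identities of relatively free algebras *)

Section FreeAlgebraTheory.
Variables (K : fieldType) (I : choiceType).
Implicit Types (A B : algType K) (f : freealg K I).

Lemma freealg_words f :
  f = \sum_(w <- msupp f) f@_w *: \prod_(i <- (w : seq I)) fvar K i.
Proof.
rewrite {1}[f]monalgE; apply: eq_bigr => w _.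
have -> : << f@_w *g w >> = f@_w *: (<< w >> : freealg K I).
  apply/malgP => v.
  by rewrite [LHS]mcoeffU [RHS]mcoeffZ [X in _ * X]mcoeffU mulr_natr.
congr (_ *: _); case: w => w /=; elim: w => [|i w IHw].
  by rewrite big_nil -fmE.
rewrite big_cons -IHw fvar.unlock malgM_def fgmulUU mulr1.
by congr << _ >>; apply: val_inj; rewrite /= fmM fmU.
Qed.

Lemma freealg_word_sum f : exists L : seq (K * seq I),
  f = \sum_(p <- L) p.1 *: \prod_(i <- p.2) fvar K i.
Proof.
exists [seq (f@_w, w : seq I) | w <- msupp f].
by rewrite big_map -freealg_words.
Qed.

Lemma freealg_ind (P : freealg K I -> Prop) :
    P 1 -> (forall i, P (fvar K i)) -> (forall f g, P f -> P g -> P (f + g)) ->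
    (forall f g, P f -> P g -> P (f * g)) -> (forall c f, P f -> P (c *: f)) ->
  forall f, P f.
Proof.
move=> P1 Pv PD PM PZ f; rewrite [f]freealg_words.
have P0 : P 0 by rewrite -(scale0r 1); exact: PZ.
apply: big_ind => // w _; apply: PZ; exact: big_ind.
Qed.

Lemma feval_comp A B (h : {lrmorphism A -> B}) (a : I -> A) f :
  h (feval a f) = feval (fun i => h (a i)) f.
Proof.
elim/freealg_ind: f => [|i|f g IHf IHg|f g IHf IHg|c f IHf].
- by rewrite !rmorph1.
- by rewrite !feval_var.
- by rewrite !raddfD /= IHf IHg.
- by rewrite !rmorphM /= IHf IHg.
- by rewrite !linearZ /= IHf.
Qed.

Lemma eq_feval A (a b : I -> A) f : a =1 b -> feval a f = feval b f.
Proof. by move=> /funext ->. Qed.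

Lemma feval_fvar f : feval (fvar K) f = f.
Proof.
elim/freealg_ind: f => [|i|f g IHf IHg|f g IHf IHg|c f IHf].
- by rewrite !rmorph1.
- by rewrite !feval_var.
- by rewrite !raddfD /= IHf IHg.
- by rewrite !rmorphM /= IHf IHg.
- by rewrite !linearZ /= IHf.
Qed.

End FreeAlgebraTheory.

Section IdentitiesTheory.
Variable K : fieldType.
Local Notation KX := (freealg K nat).

Lemma Id_T_ideal (A : algType K) : T_ideal (Id A).
Proof.
split=> [|phi f f0 a]; last first.
  have -> : phi f = feval (fun i => phi (fvar K i)) f.
    by rewrite -[f in LHS]feval_fvar feval_comp.
  by rewrite feval_comp; exact: f0.
split=> [a|f g f0 g0 a|f g g0 a|f g f0 a].
- exact: raddf0.
- by rewrite raddfB /= f0 g0 subrr.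
- by rewrite rmorphM /= g0 mulr0.
- by rewrite rmorphM /= f0 mul0r.
Qed.

Lemma T_ideal_gen_ideal (S : set KX) : T_ideal (T_ideal_gen S).
Proof.
split=> [|phi f Jf J JS]; last first.
  by case: (JS) => TJ _; apply: (T_ideal_endo TJ); exact: Jf.
split=> [J [TJ _]|f g Jf Jg J JS|f g Jg J JS|f g Jf J JS].
- exact: ideal0 (T_ideal_ideal TJ).
- case: (JS) => TJ _.
  exact: idealB (T_ideal_ideal TJ) _ _ (Jf J JS) (Jg J JS).
- by case: (JS) => TJ _; apply: (idealMl (T_ideal_ideal TJ)); exact: Jg.
- by case: (JS) => TJ _; apply: (Defs.idealMr (T_ideal_ideal TJ)); exact: Jf.
Qed.

Lemma T_ideal_feval (J : set KX) (a : nat -> KX) f :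
  T_ideal J -> J f -> J (feval a f).
Proof. by move=> TJ; exact: (T_ideal_endo TJ (feval a)). Qed.

(** Elements of F_n lift to polynomials in n variables, so an identity of F_n is a
    polynomial all of whose values on such polynomials lie in I_(p+1). *)
Lemma Id_relfreeP n p (p_gt0 : (0 < p)%N) (f : KX) :
  Id (relfree K n p p_gt0) f <->
  forall h : nat -> freealg K 'I_n,
    commutator_ideal p.+1 (feval (fun i => freealg_incl (h i)) f).
Proof.
have evE h : (feval (fun i => aqpi (relfree_ideal K n p_gt0) (h i)) f = 0) <->
    commutator_ideal p.+1 (feval (fun i => freealg_incl (h i)) f).
  rewrite -(feval_comp (aqpi _)) -(feval_comp (@freealg_incl K n)).
  by rewrite -(raddf0 (aqpi (relfree_ideal K n p_gt0))) aqpiP subr0.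
split=> [f0 h|f0 a]; first exact/evE/f0.
have -> : a = fun i => aqpi (relfree_ideal K n p_gt0) (repr (a i)).
  by apply/funext => i; rewrite aqpi_repr.
exact/evE.
Qed.

Lemma Id_relfree_leq m n p (p_gt0 : (0 < p)%N) : (m <= n)%N ->
  Id (relfree K n p p_gt0) `<=` Id (relfree K m p p_gt0).
Proof.
move=> le_mn f /Id_relfreeP f0; apply/Id_relfreeP => h.
pose widen : freealg K 'I_m -> freealg K 'I_n :=
  feval (fun i => fvar K (widen_ord le_mn i)).
have -> : (fun i => freealg_incl (h i)) = (fun i => freealg_incl (widen (h i))).
  apply/funext => i; rewrite /freealg_incl /widen (feval_comp (@freealg_incl K n)).
  apply: eq_feval => j; symmetry; exact: feval_var.
exact: f0.
Qed.
End IdentitiesTheory.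

(** * Evaluation in an algebra with two generators *)

Section CommutatorLinear.
Variables (K : fieldType) (A : algType K).
Implicit Types a b c : A.

Lemma comm2Dl a b c : ⟦a + b, c⟧ = ⟦a, c⟧ + ⟦b, c⟧.
Proof. by rewrite /comm2 mulrDl mulrDr opprD addrACA. Qed.

Lemma comm2Dr a b c : ⟦a, b + c⟧ = ⟦a, b⟧ + ⟦a, c⟧.
Proof. by rewrite /comm2 mulrDl mulrDr opprD addrACA. Qed.

Lemma comm2Zl k a b : ⟦k *: a, b⟧ = k *: ⟦a, b⟧.
Proof. by rewrite /comm2 -scalerAl -scalerAr -scalerBr. Qed.

Lemma comm2Zr k a b : ⟦a, k *: b⟧ = k *: ⟦a, b⟧.
Proof. by rewrite /comm2 -scalerAl -scalerAr -scalerBr. Qed.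

Lemma comm2_1l a : ⟦1, a⟧ = 0.
Proof. by rewrite /comm2 mul1r mulr1 subrr. Qed.

Lemma comm2_1r a : ⟦a, 1⟧ = 0.
Proof. by rewrite /comm2 mul1r mulr1 subrr. Qed.

Lemma comm2xx a : ⟦a, a⟧ = 0.
Proof. exact: subrr. Qed.
End CommutatorLinear.

Lemma lrmorph_affine (K : fieldType) (A B : algType K)
    (h : {lrmorphism A -> B}) c s t a b :
  h (c *: 1 + s *: a + t *: b) = c *: 1 + s *: h a + t *: h b.
Proof. by rewrite !raddfD /= !linearZ /= rmorph1. Qed.

Lemma ker_two_sided_ideal (R S : nzRingType) (h : {rmorphism R -> S}) :
  two_sided_ideal [set a | h a = 0].
Proof.
split=> [|a b a0 b0|a b b0|a b a0] /=.
- exact: rmorph0.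
- by rewrite rmorphB a0 b0 subrr.
- by rewrite rmorphM b0 mulr0.
- by rewrite rmorphM a0 mul0r.
Qed.

Section HeisenbergImage.
Variables (K : fieldType) (B : algType K) (u v z : B).
Hypotheses (uvz : ⟦u, v⟧ = z) (uz : u * z = z * u) (vz : v * z = z * v).
Hypotheses (z2u : z * z * u = 0) (z2v : z * z * v = 0).
Local Notation KX := (freealg K nat).

Let gen (i : nat) : B := nth 0 [:: u; v] i.
Local Notation ev := (feval gen).

(* z commutes with the generators, hence with the algebra they generate. *)
Let ev_z f : ev f * z = z * ev f.
Proof.
elim/freealg_ind: f => [|i|f g IHf IHg|f g IHf IHg|c f IHf].
- by rewrite rmorph1 mulr1 mul1r.
- rewrite feval_var /gen.
  by case: i => [|[|i]] //=; rewrite ?nth_nil mulr0 mul0r.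
- by rewrite rmorphD /= mulrDl mulrDr IHf IHg.
- by rewrite rmorphM /= -mulrA IHg !mulrA IHf.
- by rewrite linearZ /= -scalerAl -scalerAr IHf.
Qed.

(* Since z is central, the elements f with [f, y] in z B' form a subalgebra, where
   B' is the algebra generated by u and v. *)
Let comm_image y : (forall i, exists k, ⟦gen i, y⟧ = z * ev k) ->
  forall f, exists k, ⟦ev f, y⟧ = z * ev k.
Proof.
move=> gen_y; elim/freealg_ind=> [|i|f g [k1 IHf] [k2 IHg]|
  f g [k1 IHf] [k2 IHg]|c f [k IHf]].
- by exists 0; rewrite rmorph1 rmorph0 mulr0 comm2_1l.
- by have [k yk] := gen_y i; exists k; rewrite feval_var yk.
- by exists (k1 + k2); rewrite !rmorphD /= comm2Dl IHf IHg mulrDr.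
- exists (f * k2 + k1 * g); rewrite rmorphM /= comm2_Ml IHf IHg.
  transitivity (z * (ev f * ev k2 + ev k1 * ev g)).
    by rewrite mulrA ev_z mulrDr !mulrA.
  by congr (_ * _); rewrite rmorphD; congr (_ + _); rewrite rmorphM.
- exists (c *: k); transitivity (c *: ⟦ev f, y⟧).
    by rewrite -comm2Zl; congr comm2; exact: linearZ.
  by rewrite IHf scalerAr; congr (_ * _); symmetry; exact: linearZ.
Qed.

Let comm_ev f g : exists k, ⟦ev f, ev g⟧ = z * ev k.
Proof.
apply: comm_image => i.
have [k fk] : exists k, ⟦ev g, gen i⟧ = z * ev k.
  apply: comm_image => j; case: i j => [|[|i]] [|[|j]]; rewrite /gen /= ?nth_nil.
  all: try by exists 0; rewrite rmorph0 mulr0 /comm2 ?(mulr0, mul0r) subrr.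
  - by exists (- 1); rewrite rmorphN rmorph1 comm2_antisym uvz mulrN1.
  - by exists 1; rewrite uvz rmorph1 mulr1.
by exists (- k); rewrite comm2_antisym fk rmorphN mulrN.
Qed.

Let z3 : z * z * z = 0.
Proof. by rewrite -{3}uvz mulrBr !mulrA z2u z2v !mul0r subrr. Qed.

(* Each further commutator contributes a factor z, and z^3 = 0. *)
Let nil_ev f g h k : ⟦⟦ev f, ev g, ev h⟧, ev k⟧ = 0.
Proof.
have [k1 ->] := comm_ev f g.
have zl a b : ⟦z * ev a, ev b⟧ = z * ⟦ev a, ev b⟧.
  by rewrite comm2_Ml /(comm2 z) ev_z subrr mul0r addr0.
have [k2] := comm_ev k1 h; rewrite zl => ->.
rewrite comm2_Ml zl; have [k3 ->] := comm_ev k2 k.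
by rewrite /(comm2 z) ev_z subrr mul0r addr0 !mulrA z3 mul0r.
Qed.

Lemma heis_commutator_ideal f :
  commutator_ideal 4 f -> feval gen f = 0.
Proof.
move=> /(_ [set g : KX | ev g = 0]); apply; split; first exact: ker_two_sided_ideal.
move=> _ [[[|a [|b [|c [|d [|]]]]] //= _] _ <-].
by rewrite !rmorph_comm2 nil_ev.
Qed.

(** B may not be generated by u and v, but the values lie in the subalgebra which
    they generate, a homomorphic image of F_2. *)
Lemma Id_relfree2_heis f (h : nat -> freealg K 'I_2) :
  Id (relfree K 2 3 isT) f ->
  feval (fun i => feval (fun j : 'I_2 => gen j) (h i)) f = 0.
Proof.
move=> /Id_relfreeP/(_ h)/heis_commutator_ideal <-.
rewrite (feval_comp ev); apply: eq_feval => i.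
rewrite /freealg_incl (feval_comp ev).
apply: eq_feval => j. symmetry; exact: feval_var.
Qed.

(** The generic point c_i + s_i u + t_i q, where q will be v or v^2. *)
Definition probe (q : B) (c s t : nat -> K) (i : nat) : B :=
  c i *: 1 + s i *: u + t i *: q.

Lemma Id_relfree2_probe f c s t : Id (relfree K 2 3 isT) f ->
  (feval (probe v c s t) f = 0) * (feval (probe (v * v) c s t) f = 0).
Proof.
pose X (j : 'I_2) := fvar K j.
pose h Y i : freealg K 'I_2 := c i *: 1 + s i *: X 0 + t i *: Y.
have evX (j : 'I_2) : gen j = feval (fun i : 'I_2 => gen i) (X j).
  by symmetry; exact: feval_var.
move=> Idf; split.
  rewrite -[RHS](Id_relfree2_heis (h (X 1)) Idf); apply: eq_feval => i.
  rewrite lrmorph_affine /probe.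
  by congr (_ + _ *: _ + _ *: _); [exact: (evX 0) | exact: (evX 1)].
rewrite -[RHS](Id_relfree2_heis (h (X 1 * X 1)) Idf); apply: eq_feval => i.
rewrite lrmorph_affine /probe.
congr (_ + _ *: _ + _ *: _); first exact: (evX 0).
by rewrite rmorphM; congr (_ * _); exact: (evX 1).
Qed.

Section Points.
Variables c s t : nat -> K.

Definition minor (i j : nat) : K := s i * t j - s j * t i.

Lemma probe_comm q i j :
  ⟦probe q c s t i, probe q c s t j⟧ = minor i j *: ⟦u, q⟧.
Proof.
rewrite /probe !(comm2Dl, comm2Dr, comm2Zl, comm2Zr, comm2_1l, comm2_1r, comm2xx).
rewrite !scaler0 !(add0r, addr0) (comm2_antisym q u) !scalerN !scalerA.
by rewrite -scalerBl [t i * _]mulrC.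
Qed.

(** Multiplication by z^2 annihilates u and q, so only the constants c_i remain. *)
Lemma word_probe_z2 q w : q * (z * z) = 0 ->
  word (probe q c s t) w * (z * z) = mono c w *: (z * z).
Proof.
move=> qz2; have uz2 : u * (z * z) = 0 by rewrite mulrA uz -mulrA uz mulrA z2u.
elim: w => [|i w IHw]; first by rewrite /word /mono !big_nil mul1r scale1r.
rewrite word_cons -mulrA IHw /probe /mono big_cons -scalerAr !mulrDl.
by rewrite -!scalerAl qz2 uz2 mul1r !scaler0 !addr0 scalerA mulrC.
Qed.
End Points.
End HeisenbergImage.

(** * A model by matrices of order six *)

Section HeisenbergMatrices.
Variable K : fieldType.

Let e (i j : nat) : 'M[K]_6 := delta_mx (inord i) (inord j).
Let mulee i j k l : (j < 6)%N -> (k < 6)%N -> e i j * e k l = e i l *+ (j == k).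
Proof.
move=> j6 k6; rewrite /e -mulmxE mul_delta_mx_cond; congr (_ *+ nat_of_bool _).
by apply/eqP/eqP => [/(congr1 val)|->//]; rewrite /= !inordK.
Qed.

(** On polynomials in x and z, let v be the multiplication by x and u = z d/dx, so
    that [u, v] is the multiplication by z.  Both act on the quotient by
    (x^3, z x^2, z^2 x, z^3), with basis 1, x, x^2, z, z x, z^2, in this order. *)
Lemma heis_matrices : exists u v z : 'M[K]_6,
  [/\ ⟦u, v⟧ = z, u * z = z * u & v * z = z * v] /\
  [/\ z * z * u = 0, z * z * v = 0 & z * z != 0].
Proof.
pose u : 'M[K]_6 := e 3 1 + e 4 2 *+ 2 + e 5 4.
pose v : 'M[K]_6 := e 1 0 + e 2 1 + e 4 3.
pose z : 'M[K]_6 := e 3 0 + e 4 1 + e 5 3.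
have simp := (mulrDl, mulrDr, mulrnAl, mulrnAr, mulee, addr0, add0r, mulr0n,
  mulr1n, mul0rn).
have z2 : z * z = e 5 0 by rewrite /z !simp.
exists u, v, z; rewrite z2 /u /v /z; split; split; rewrite ?simp //=.
- by rewrite /comm2 !simp //= addrA addrAC -addrA addrA addrK.
- apply/eqP => /matrixP/(_ (inord 5) (inord 0)) /eqP.
  by rewrite !mxE !eqxx oner_eq0.
Qed.
End HeisenbergMatrices.

(** * Linear spans of commutator terms *)

Section Spans.
Variables (K : fieldType) (A : algType K).

Definition lincomb (T : Type) (G : T -> A) (L : seq (K * T)) : A :=
  \sum_(p <- L) p.1 *: G p.2.

Definition in_span (T : Type) (G : T -> A) (a : A) : Prop :=
  exists L, a = lincomb G L.

Section InSpan.
Variables (T : Type) (G : T -> A).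

Lemma span0 : in_span G 0.
Proof. by exists [::]; rewrite /lincomb big_nil. Qed.

Lemma spanD a b : in_span G a -> in_span G b -> in_span G (a + b).
Proof. by move=> [L1 ->] [L2 ->]; exists (L1 ++ L2); rewrite /lincomb big_cat. Qed.

Lemma spanZ k a : in_span G a -> in_span G (k *: a).
Proof.
move=> [L ->]; exists [seq (k * p.1, p.2) | p <- L].
by rewrite /lincomb big_map scaler_sumr; apply: eq_bigr => p _; rewrite scalerA.
Qed.

Lemma span_gen t : in_span G (G t).
Proof. by exists [:: (1, t)]; rewrite /lincomb big_seq1 scale1r. Qed.

Lemma span_sum (I : Type) (r : seq I) (F : I -> A) :
  (forall i, in_span G (F i)) -> in_span G (\sum_(i <- r) F i).
Proof. by move=> spF; apply: big_ind => //; [exact: span0|exact: spanD]. Qed.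

Lemma span_mull (T' : Type) (G' : T' -> A) a b :
  (forall t, in_span G (a * G' t)) -> in_span G' b -> in_span G (a * b).
Proof.
move=> spa [L ->]; rewrite mulr_sumr; apply: span_sum => p.
by rewrite -scalerAr; apply: spanZ.
Qed.

Lemma span_mulr (T' : Type) (G' : T' -> A) a b :
  (forall t, in_span G (G' t * a)) -> in_span G' b -> in_span G (b * a).
Proof.
move=> spa [L ->]; rewrite mulr_suml; apply: span_sum => p.
by rewrite -scalerAl; apply: spanZ.
Qed.

Lemma span_trans (T' : Type) (G' : T' -> A) b :
  (forall t, in_span G (G' t)) -> in_span G' b -> in_span G b.
Proof.
move=> spG' spb; rewrite -[b]mul1r; apply: span_mull spb => t.
by rewrite mul1r.
Qed.

End InSpan.

Lemma lincomb_split (T1 T2 : Type) (G : T1 + T2 -> A) L : exists L1 L2,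
  lincomb G L = lincomb (fun t => G (inl t)) L1 + lincomb (fun t => G (inr t)) L2.
Proof.
elim: L => [|[k t] L [L1 [L2 IHL]]].
  by exists [::], [::]; rewrite /lincomb !big_nil addr0.
rewrite /lincomb in IHL; case: t => t.
  by exists ((k, t) :: L1), L2; rewrite /lincomb !big_cons IHL addrA.
by exists L1, ((k, t) :: L2); rewrite /lincomb !big_cons IHL addrCA.
Qed.

End Spans.

Section Terms.
Variables (R : nzRingType) (x : nat -> R).

Definition pair_term (t : seq nat * (nat * nat)) : R :=
  word x t.1 * ⟦x t.2.1, x t.2.2⟧.

Definition triple_term (t : seq nat * (nat * nat * nat)) : R :=
  word x t.1 * ⟦x t.2.1.1, x t.2.1.2, x t.2.2⟧.

Definition quad_term (t : seq nat * (nat * nat * (nat * nat))) : R :=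
  word x t.1 * (⟦x t.2.1.1, x t.2.1.2⟧ * ⟦x t.2.2.1, x t.2.2.2⟧).

(** The terms of the last two layers. *)
Definition tail3_term t : R :=
  match t with inl t => triple_term t | inr t => quad_term t end.

(** The terms of all layers but the first. *)
Definition tail2_term t : R :=
  match t with inl t => pair_term t | inr t => tail3_term t end.

End Terms.

Section TermsMorphism.
Variables (R S : nzRingType) (h : {rmorphism R -> S}) (x : nat -> R) (y : nat -> S).
Hypothesis hx : forall i, h (x i) = y i.

Lemma rmorph_word w : h (word x w) = word y w.
Proof. by rewrite rmorph_prod; apply: eq_bigr. Qed.

Lemma rmorph_triple_term t : h (triple_term x t) = triple_term y t.
Proof. by rewrite rmorphM !rmorph_comm2 !hx rmorph_word. Qed.

Lemma rmorph_pair_term t : h (pair_term x t) = pair_term y t.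
Proof. by rewrite rmorphM !rmorph_comm2 !hx rmorph_word. Qed.

Lemma rmorph_quad_term t : h (quad_term x t) = quad_term y t.
Proof. by rewrite rmorphM [X in _ * X]rmorphM !rmorph_comm2 !hx rmorph_word. Qed.

Lemma rmorph_tail3_term t : h (tail3_term x t) = tail3_term y t.
Proof. case: t => t; [exact: rmorph_triple_term | exact: rmorph_quad_term]. Qed.

Lemma rmorph_tail2_term t : h (tail2_term x t) = tail2_term y t.
Proof. case: t => t; [exact: rmorph_pair_term | exact: rmorph_tail3_term]. Qed.
End TermsMorphism.

Section TermsEval.
Variables (K : fieldType) (A : algType K) (x : nat -> A).

Lemma feval_lincomb (T : Type) (G : T -> freealg K nat) (H : T -> A) L :
  (forall t, feval x (G t) = H t) -> feval x (lincomb G L) = lincomb H L.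
Proof.
move=> evG; rewrite linear_sum; apply: eq_bigr => p _.
by rewrite linearZ /= evG.
Qed.

End TermsEval.

Section TermSpans.
Variables (K : fieldType) (A : algType K) (x : nat -> A).
Hypothesis nil3 : forall a b c d : A, ⟦⟦a, b, c⟧, d⟧ = 0.
Hypothesis tf3 : forall a : A, a *+ 3 = 0 -> a = 0.
Hypothesis pfaff0 : forall a b c d : A, pfaff4 a b c d = 0.

Local Notation span2 := (in_span (tail2_term x)).
Local Notation span3 := (in_span (tail3_term x)).
Local Notation span4 := (in_span (quad_term x)).

Lemma span4_span3 a : span4 a -> span3 a.
Proof. by apply: span_trans => t; exact: (span_gen (tail3_term x) (inr t)). Qed.

Lemma span3_span2 a : span3 a -> span2 a.
Proof. by apply: span_trans => t; exact: (span_gen (tail2_term x) (inr t)). Qed.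

Lemma triple_span3 t : span3 (triple_term x t).
Proof. exact: (span_gen (tail3_term x) (inl t)). Qed.

Lemma pair_span2 t : span2 (pair_term x t).
Proof. exact: (span_gen (tail2_term x) (inl t)). Qed.

Lemma letter_pair i t : x i * pair_term x t = pair_term x (i :: t.1, t.2).
Proof. by rewrite /pair_term word_cons mulrA. Qed.

Lemma letter_triple i t : x i * triple_term x t = triple_term x (i :: t.1, t.2).
Proof. by rewrite /triple_term word_cons mulrA. Qed.

Lemma letter_quad i t : x i * quad_term x t = quad_term x (i :: t.1, t.2).
Proof. by rewrite /quad_term word_cons [LHS]mulrA. Qed.

Lemma span4_letter_mull i a : span4 a -> span4 (x i * a).
Proof. by apply: span_mull => t; rewrite letter_quad; apply: span_gen. Qed.

Lemma span2_letter_mull i a : span2 a -> span2 (x i * a).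
Proof.
apply: span_mull => -[t|[t|t]] /=.
- by rewrite letter_pair; apply: pair_span2.
- by rewrite letter_triple; apply/span3_span2/triple_span3.
- by rewrite letter_quad; apply/span3_span2/span4_span3/span_gen.
Qed.

Lemma span4_word_mull w a : span4 a -> span4 (word x w * a).
Proof.
move=> spa; elim: w => [|i w IHw]; first by rewrite /word big_nil mul1r.
by rewrite word_cons -mulrA; apply: span4_letter_mull.
Qed.

(** A letter passes to the left of a pair at the cost of a triple, and it commutes
    with triples and with products of two pairs. *)
Lemma span2_letter_mulr i a : span2 a -> span2 (a * x i).
Proof.
apply: span_mulr => -[t|[t|t]] /=.
- have -> : pair_term x t * x i = pair_term x (rcons t.1 i, t.2)
      + triple_term x (t.1, (t.2.1, t.2.2, i)).
    rewrite /pair_term /triple_term word_rcons /= -!mulrA -mulrDr.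
    by congr (_ * _); rewrite addrC subrK.
  apply: spanD; first exact: pair_span2.
  exact/span3_span2/triple_span3.
- have -> : triple_term x t * x i = triple_term x (rcons t.1 i, t.2).
    by rewrite /triple_term word_rcons /= -!mulrA triple_central.
  exact/span3_span2/triple_span3.
- have -> : quad_term x t * x i = quad_term x (rcons t.1 i, t.2).
    by rewrite /quad_term word_rcons /= -[RHS]mulrA -[LHS]mulrA pair_pair_central.
  exact/span3_span2/span4_span3/span_gen.
Qed.

Lemma span2_word_mulr w a : span2 a -> span2 (a * word x w).
Proof.
elim: w a => [|i w IHw] a spa; first by rewrite /word big_nil mulr1.
by rewrite word_cons mulrA; apply/IHw/span2_letter_mulr.
Qed.

Lemma word_comm_span2 v i : span2 ⟦word x v, x i⟧.
Proof.
elim: v => [|j v IHv]; first by rewrite /word big_nil comm2_1l; apply: span0.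
rewrite word_cons comm2_Ml; apply: spanD; first exact: span2_letter_mull.
by apply: span2_word_mulr; have := pair_span2 ([::], (j, i));
  rewrite /pair_term /word big_nil mul1r.
Qed.

Lemma word_comm_pair_span4 v i j k :
  span4 (⟦word x v, x i⟧ * ⟦x j, x k⟧).
Proof.
elim: v => [|l v IHv].
  by rewrite /word big_nil comm2_1l mul0r; apply: span0.
rewrite word_cons comm2_Ml mulrDl; apply: spanD.
  by rewrite -mulrA; apply: span4_letter_mull.
by rewrite -mulrA pair_absorb //; exact: (span_gen _ (v, (l, i, (j, k)))).
Qed.

(** Reordering costs terms with a commutator in the first layer, terms with two
    commutators in the second one, and nothing in the last two. *)
Lemma word_sort_span2 w : span2 (word x w - word x (sort leq w)).
Proof.
rewrite -[word x w]mulr1 -[word x (sort _ _)]mulr1.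
apply: word_perm_mod; rewrite ?perm_sort //; [exact: span0|exact: spanD|..].
  exact: span2_letter_mull.
by move=> v i w'; rewrite mulr1; apply/span2_word_mulr/word_comm_span2.
Qed.

Lemma pair_sort_span4 t :
  span4 (pair_term x t - pair_term x (sort leq t.1, t.2)).
Proof.
apply: word_perm_mod; rewrite ?perm_sort //; [exact: span0|exact: spanD|..].
  exact: span4_letter_mull.
move=> v i w; rewrite pair_absorb //.
exact/span4_word_mull/word_comm_pair_span4.
Qed.

Lemma triple_sort t : triple_term x (sort leq t.1, t.2) = triple_term x t.
Proof.
apply/esym/subr0_eq/(word_perm_mod (S := fun a => a = 0)); rewrite ?perm_sort //.
- by move=> a b -> ->; rewrite addr0.
- by move=> i a ->; rewrite mulr0.
- by move=> v i w; rewrite -triple_central // mulrA pair_triple0 // mul0r.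
Qed.

Lemma quad_sort t : quad_term x (sort leq t.1, t.2) = quad_term x t.
Proof.
apply/esym/subr0_eq/(word_perm_mod (S := fun a => a = 0)); rewrite ?perm_sort //.
- by move=> a b -> ->; rewrite addr0.
- by move=> i a ->; rewrite mulr0.
- move=> v i w; rewrite [word x w * _]mulrA pair_absorb // -mulrA mulrA.
  by rewrite -!mulrA ![_ * (⟦_, _⟧ * ⟦_, _⟧)]mulrA pair_pair_pair0 // mulr0.
Qed.
End TermSpans.

(** * Recovering a polynomial from its values *)

Section CharZero.
Variables (K : fieldType) (charK0 : [pchar K] =i pred0) (V : lmodType K).

Lemma natr_neq0_char0 n : (n.+1%:R : K) != 0.
Proof. by have /pcharf0P -> := charK0. Qed.

Lemma mulrn_eq0_char0 n (a : V) : a *+ n.+1 = 0 -> a = 0.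
Proof.
move/eqP; rewrite -scaler_nat scaler_eq0 (negPf (natr_neq0_char0 n)).
by move/eqP.
Qed.
End CharZero.

Lemma span_mulrn_inv (K : fieldType) (charK0 : [pchar K] =i pred0)
    (A : algType K) (T : Type) (G : T -> A) n a :
  in_span G (a *+ n.+1) -> in_span G a.
Proof.
move=> /(spanZ (n.+1%:R)^-1); rewrite -scaler_nat scalerA mulVf ?scale1r //.
exact: natr_neq0_char0.
Qed.

Lemma scale_mul (K : fieldType) (A : algType K) k l (a b : A) :
  (k *: a) * (l *: b) = (k * l) *: (a * b).
Proof. by rewrite -scalerAl -scalerAr scalerA. Qed.

(** The quotient of the free algebra by T is the algebra A to keep in mind, with
    x_i the images of the variables; the kernel of the evaluation at the x_i is
    then T, and [kerJ] is the inclusion of T in J. *)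
Section Stages.
Variables (K : fieldType) (charK0 : [pchar K] =i pred0).
Variables (A : algType K) (x : nat -> A).
Hypothesis nil3 : forall a b c d : A, ⟦⟦a, b, c⟧, d⟧ = 0.
Hypothesis pfaff0 : forall a b c d : A, pfaff4 a b c d = 0.
Local Notation KX := (freealg K nat).
Local Notation X := (fvar K : nat -> freealg K nat).
Local Notation J := (Id (relfree K 2 3 isT)).
Hypothesis kerJ : forall f, feval x f = 0 -> J f.

Let tf3 (a : A) : a *+ 3 = 0 -> a = 0 := mulrn_eq0_char0 charK0 (n := 2) (a := a).

Variables (B : algType K) (u v z : B).
Hypotheses (uvz : ⟦u, v⟧ = z) (uz : u * z = z * u) (vz : v * z = z * v).
Hypotheses (z2u : z * z * u = 0) (z2v : z * z * v = 0) (z2 : z * z != 0).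

Local Notation tail2 := (tail2_term x).
Local Notation tail3 := (tail3_term x).
Local Notation quad := (quad_term x).

(** A combination of terms representing the value of f in A represents f itself
    modulo the kernel, so it may be evaluated in B in place of f. *)
Lemma Id_span_lift (T : Type) (GX : T -> KX) (G : T -> A) f :
    (forall t, feval x (GX t) = G t) -> J f -> in_span G (feval x f) ->
  exists L, J (lincomb GX L) /\ feval x f = feval x (lincomb GX L).
Proof.
move=> evG Jf [L def_f]; exists L; rewrite (feval_lincomb _ evG); split=> //.
have idJ := T_ideal_ideal (Id_T_ideal (relfree K 2 3 isT)).
rewrite -[lincomb GX L](subrK f) ; apply: (idealD idJ) Jf; apply: kerJ.
by rewrite raddfB /= (feval_lincomb _ evG) def_f subrr.
Qed.

Lemma probe_vanish f c s t : J f ->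
  (feval (probe u v c s t) f = 0) * (feval (probe u (v * v) c s t) f = 0).
Proof. exact: (Id_relfree2_probe uvz uz vz z2u z2v). Qed.

Lemma scale_z2_eq0 (a : K) : a *: (z * z) = 0 -> a = 0.
Proof. by move/eqP; rewrite scaler_eq0 (negPf z2) orbF => /eqP. Qed.

Let vz2 : v * (z * z) = 0. Proof. by rewrite mulrA vz -mulrA vz mulrA. Qed.
Let vvz2 : v * v * (z * z) = 0. Proof. by rewrite -mulrA vz2 mulr0. Qed.
Let z3 : z * z * z = 0.
Proof. by rewrite -{3}uvz mulrBr !mulrA z2u z2v !mul0r subrr. Qed.

Let word_z2 c s t w : word (probe u v c s t) w * (z * z) = mono c w *: (z * z).
Proof. exact: (word_probe_z2 uz z2u). Qed.

Let word_z2' c s t w :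
  word (probe u (v * v) c s t) w * (z * z) = mono c w *: (z * z).
Proof. exact: (word_probe_z2 uz z2u). Qed.

Let comm_probe c s t i j :
  ⟦probe u v c s t i, probe u v c s t j⟧ = minor s t i j *: z.
Proof. by rewrite probe_comm uvz. Qed.

Let z_probe c s t i : ⟦z, probe u v c s t i⟧ = 0.
Proof.
rewrite /probe !comm2Dr !comm2Zr comm2_1r /comm2 uz vz !subrr.
by rewrite !scaler0 !addr0.
Qed.

Let feval_word y w : feval y (word X w) = word y w :> B.
Proof. by rewrite (rmorph_word (y := y)) // => i; exact: feval_var. Qed.

Lemma tail3_z c s t p : tail3_term (probe u v c s t) p * z = 0.
Proof.
case: p => p /=; rewrite /triple_term /quad_term !comm_probe.
  by rewrite comm2Zl z_probe scaler0 mulr0 mul0r.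
by rewrite scale_mul -scalerAr -scalerAl -mulrA z3 mulr0 scaler0.
Qed.

(** The first layer; the coefficient of z^2 is a polynomial in c alone. *)
Lemma Id_span_tail2 f : J f -> in_span tail2 (feval x f).
Proof.
move=> Jf; have [L def_f] := freealg_word_sum f.
have evx : feval x f = \sum_(p <- L) p.1 *: word x p.2.
  rewrite def_f linear_sum; apply: eq_bigr => p _.
  rewrite linearZ; congr (_ *: _).
  by apply: rmorph_word => i; exact: feval_var.
have test c : \sum_(p <- L) p.1 * mono c p.2 = 0.
  apply: scale_z2_eq0; rewrite scaler_suml.
  transitivity (feval (probe u v c (fun=> 0) (fun=> 0)) f * (z * z)); last first.
    by rewrite probe_vanish ?mul0r.
  rewrite def_f linear_sum mulr_suml; apply: eq_bigr => p _.
  by rewrite linearZ /= (feval_word _ p.2) -scalerAl word_z2 scalerA.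
have := @vanishing_poly_apply3 _ charK0 A
  [seq (p.1, (p.2, [::], [::])) | p <- L] (fun cs _ _ => word x cs).
rewrite !big_map => vanish.
rewrite -[feval x f]subr0 -{}vanish ?evx -?sumrB => [|c s t].
  apply: span_sum => p /=; rewrite -scalerBr; apply/spanZ/word_sort_span2 => //.
rewrite big_map -[RHS](test c); apply: eq_bigr => p _ /=.
by rewrite /mono !big_nil !mulr1.
Qed.

(** The second layer; multiplication by z annihilates the values of the last two. *)
Lemma Id_span_tail3 f :
  J f -> in_span tail2 (feval x f) -> in_span tail3 (feval x f).
Proof.
move=> Jf /(Id_span_lift (rmorph_tail2_term (feval_var x)) Jf) {f Jf} [L0 [J0 ->]].
have [L [L' def_L0]] := lincomb_split (tail2_term X) L0.
rewrite {}def_L0 in J0 *.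
have test c s t :
    \sum_(p <- L) p.1 * (mono c p.2.1 * minor s t p.2.2.1 p.2.2.2) = 0.
  apply: scale_z2_eq0; set y := probe u v c s t.
  transitivity (feval y (lincomb (pair_term X) L + lincomb (tail3_term X) L') * z);
    last by rewrite (probe_vanish c s t J0) mul0r.
  rewrite raddfD /= (feval_lincomb _ (rmorph_pair_term (feval_var y))).
  rewrite (feval_lincomb _ (rmorph_tail3_term (feval_var y))).
  rewrite mulrDl !mulr_suml [X in _ = _ + X]big1 => [|p _]; last first.
    by rewrite -scalerAl tail3_z scaler0.
  rewrite addr0 scaler_suml; apply: eq_bigr => p _.
  rewrite /pair_term comm_probe -scalerAl -scalerAr -scalerAl -mulrA word_z2.
  by rewrite !scalerA -mulrA [mono _ _ * _]mulrC.
rewrite raddfD /= (feval_lincomb _ (rmorph_pair_term (feval_var x))).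
rewrite (feval_lincomb _ (rmorph_tail3_term (feval_var x))).
apply: spanD; last by exists L'.
apply/span4_span3/(span_mulrn_inv charK0 (n := 1)).
(* The two terms of the minor s_i t_j - s_j t_i. *)
pose split (p : K * (seq nat * (nat * nat))) := let: (a, (w, (i, j))) := p in
  [:: (a, (w, [:: i], [:: j])); (- a, (w, [:: j], [:: i]))].
have := @vanishing_poly_apply3 _ charK0 A (flatten (map split L))
  (fun cs ss ts => word x cs * ⟦x (head 0%N ss), x (head 0%N ts)⟧).
rewrite !big_flatten !big_map => vanish.
rewrite -[_ *+ 2]subr0 -{}vanish => [|c s t].
  rewrite -sumrMnl -sumrB; apply: span_sum => -[a [w [i j]]] /=.
  rewrite !big_cons big_nil addr0 /= (comm2_antisym (x j)) mulrN scalerN.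
  rewrite scaleNr opprK -mulr2n -mulrnBl -scalerBr mulr2n.
  by apply: spanD; apply: spanZ; exact: (pair_sort_span4 _ nil3 tf3 (w, (i, j))).
rewrite big_flatten big_map -[RHS](test c s t).
apply: eq_bigr => -[a [w [i j]]] _ /=.
rewrite !big_cons big_nil addr0 /= !mono1 /minor mulNr -mulrBr.
by rewrite -!mulrA -mulrBr.
Qed.

(** The third layer; q = v^2 gives [u, q, u] = - 2 z^2 and kills the last layer. *)
Lemma Id_span_quad f : J f -> in_span tail3 (feval x f) -> in_span quad (feval x f).
Proof.
move=> Jf /(Id_span_lift (rmorph_tail3_term (feval_var x)) Jf) {f Jf} [L0 [J0 ->]].
have [L [L' def_L0]] := lincomb_split (tail3_term X) L0.
rewrite {}def_L0 in J0 *.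
have test c s t : \sum_(p <- L)
    p.1 * (mono c p.2.1 * minor s t p.2.2.1.1 p.2.2.1.2 * s p.2.2.2) = 0.
  apply/scale_z2_eq0/(mulrn_eq0_char0 charK0 (n := 1)).
  set y := probe u (v * v) c s t.
  transitivity (- feval y (lincomb (triple_term X) L + lincomb (quad_term X) L'));
    last by rewrite (probe_vanish c s t J0) oppr0.
  rewrite raddfD /= (feval_lincomb _ (rmorph_triple_term (feval_var y))).
  rewrite (feval_lincomb _ (rmorph_quad_term (feval_var y))).
  have uvv : ⟦u, v * v⟧ = (z * v) *+ 2 by rewrite comm2_Mr uvz vz mulr2n.
  have zvu : ⟦z * v, u⟧ = - (z * z).
    by rewrite comm2_Ml (comm2_antisym v) uvz mulrN /comm2 uz subrr mul0r addr0.
  have zvv : ⟦z * v, v * v⟧ = 0.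
    rewrite /comm2 -!mulrA [v * (z * v)]mulrA vz -mulrA [v * (z * _)]mulrA vz.
    by rewrite -mulrA subrr.
  have zvzv : z * v * (z * v) = 0.
    by rewrite -[z * v * _]mulrA [v * (z * v)]mulrA vz !mulrA z2v mul0r.
  rewrite [X in - (_ + X)]big1 => [|p _]; last first.
    rewrite /quad_term !probe_comm uvv scale_mul mulrnAl mulrnAr zvzv !mul0rn.
    by rewrite !scaler0 mulr0 scaler0.
  rewrite addr0 scaler_suml -sumrMnl -sumrN; apply: eq_bigr => p _.
  have zvy k : ⟦z * v *+ 2, y k⟧ = - (s k *: (z * z) *+ 2).
    rewrite /y /probe !comm2Dr !comm2Zr comm2_1r mulr2n !comm2Dl zvu zvv.
    by rewrite addr0 !scaler0 add0r addr0 -opprD scalerN scalerDr mulr2n.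
  rewrite /triple_term probe_comm uvv comm2Zl zvy scalerN mulrN scalerN opprK.
  rewrite -scalerMnr mulrnAr -scalerMnr; congr (_ *+ _).
  by rewrite -!scalerAr word_z2' !scalerA; congr (_ *: _); ring.
rewrite raddfD /= (feval_lincomb _ (rmorph_triple_term (feval_var x))).
rewrite (feval_lincomb _ (rmorph_quad_term (feval_var x))).
apply: spanD; last by exists L'.
suff -> : lincomb (triple_term x) L = 0 by apply: span0.
apply: (mulrn_eq0_char0 charK0 (n := 2)).
(* The two terms of (s_i t_j - s_j t_i) s_k. *)
pose split (p : K * (seq nat * (nat * nat * nat))) :=
  let: (a, (w, (i, j, k))) := p in
  [:: (a, (w, [:: i; k], [:: j])); (- a, (w, [:: j; k], [:: i]))].
pose sym ss ts := ⟦x (nth 0%N ss 0), x (head 0%N ts), x (nth 0%N ss 1)⟧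
  + ⟦x (nth 0%N ss 1), x (head 0%N ts), x (nth 0%N ss 0)⟧.
have sym_sort i j k : sym (sort leq [:: i; k]) [:: j] = sym [:: i; k] [:: j].
  by rewrite /sort /=; case: ifP => // _; rewrite /sym /= addrC.
have := @vanishing_poly_apply3 _ charK0 A (flatten (map split L))
  (fun cs ss ts => word x cs * sym ss ts).
rewrite !big_flatten !big_map => vanish.
rewrite -[RHS]vanish => [|c s t].
  rewrite -sumrMnl; apply: eq_bigr => -[a [w [[i j] k]]] _ /=.
  rewrite !big_cons big_nil addr0 ![sort leq [:: _]]/sort /= !sym_sort /sym /=.
  rewrite scaleNr -scalerBr -mulrBr triple_symmetrization mulrnAr scalerMnr.
  by rewrite -(triple_sort x nil3 tf3 (w, (i, j, k))).
rewrite big_flatten big_map -[RHS](test c s t).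
apply: eq_bigr => -[a [w [[i j] k]]] _ /=.
by rewrite !big_cons big_nil /= !mono1 !mono2 /minor; ring.
Qed.

(** With q = v the coefficient of z^2 is a combination of products of two minors;
    nothing remains after the symmetrization since reordering w is free here. *)
Lemma Id_span_quad_eq0 f : J f -> in_span quad (feval x f) -> feval x f = 0.
Proof.
move=> Jf /(Id_span_lift (rmorph_quad_term (feval_var x)) Jf) {f Jf} [L [J0 ->]].
have test c s t : \sum_(p <- L) p.1 * (mono c p.2.1 *
    (minor s t p.2.2.1.1 p.2.2.1.2 * minor s t p.2.2.2.1 p.2.2.2.2)) = 0.
  apply/scale_z2_eq0; set y := probe u v c s t.
  transitivity (feval y (lincomb (quad_term X) L));
    last by rewrite (probe_vanish c s t J0).
  rewrite (feval_lincomb _ (rmorph_quad_term (feval_var y))).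
  rewrite scaler_suml; apply: eq_bigr => p _.
  rewrite /quad_term !comm_probe scale_mul -!scalerAr word_z2 !scalerA.
  by congr (_ *: _); ring.
rewrite (feval_lincomb _ (rmorph_quad_term (feval_var x))).
apply: (mulrn_eq0_char0 charK0 (n := 5)).
(* The four terms of (s_i t_j - s_j t_i) (s_k t_l - s_l t_k). *)
pose split (p : K * (seq nat * (nat * nat * (nat * nat)))) :=
  let: (a, (w, (i, j, (k, l)))) := p in
  [:: (a, (w, [:: i; k], [:: j; l])); (- a, (w, [:: i; l], [:: j; k]));
      (- a, (w, [:: j; k], [:: i; l])); (a, (w, [:: j; l], [:: i; k]))].
pose sym ss ts := sym_pairs (x (nth 0%N ss 0)) (x (nth 0%N ss 1))
  (x (nth 0%N ts 0)) (x (nth 0%N ts 1)).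
have sym_sort i j k l :
    sym (sort leq [:: i; k]) (sort leq [:: j; l]) = sym [:: i; k] [:: j; l].
  rewrite /sort /=; case: ifP => _; case: ifP => _; rewrite /sym //=.
  - by rewrite sym_pairsCr.
  - by rewrite sym_pairsCl.
  - by rewrite sym_pairsCl // sym_pairsCr.
have := @vanishing_poly_apply3 _ charK0 A (flatten (map split L))
  (fun cs ss ts => word x cs * sym ss ts).
rewrite !big_flatten !big_map => vanish.
rewrite -[RHS]vanish => [|c s t].
  rewrite -sumrMnl; apply: eq_bigr => -[a [w [[i j] [k l]]]] _ /=.
  rewrite !big_cons big_nil addr0 !sym_sort /sym /=.
  rewrite !scaleNr -!scalerN -!scalerDr -!mulrN -!mulrDr.
  rewrite (pair_pair_symmetrization nil3) // mulrnAr scalerMnr.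
  by rewrite -(quad_sort x nil3 tf3 pfaff0 (w, (i, j, (k, l)))).
rewrite big_flatten big_map -[RHS](test c s t).
apply: eq_bigr => -[a [w [[i j] [k l]]]] _ /=.
by rewrite !big_cons big_nil /= !mono2 /minor; ring.
Qed.

Lemma Id_relfree2_feval0 f : J f -> feval x f = 0.
Proof.
move=> Jf; apply: Id_span_quad_eq0 => //.
exact/Id_span_quad/Id_span_tail3/Id_span_tail2.
Qed.
End Stages.

(** * The standard identity in three generators *)

Section StandardIdentity.
Variables (K : fieldType) (charK0 : [pchar K] =i pred0).
Local Notation X := (fvar K : nat -> freealg K nat).

Lemma Id_lncomm4 (A : algType K) :
  Id A (lncomm [:: X 0; X 1; X 2; X 3]) <->
  (forall a b c d : A, ⟦⟦a, b, c⟧, d⟧ = 0).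
Proof.
have evE (a : nat -> A) : feval a (lncomm [:: X 0; X 1; X 2; X 3]) =
    ⟦⟦a 0, a 1, a 2⟧, a 3⟧.
  by rewrite rmorph_lncomm /= !feval_var.
split=> [IdA a b c d|nil3 a]; last by rewrite evE.
by have := IdA (nth 0 [:: a; b; c; d]); rewrite evE.
Qed.

Lemma Id_standard4 (A : algType K) :
    (forall a b c d : A, ⟦⟦a, b, c⟧, d⟧ = 0) ->
  Id A (standard_poly (fun i : 'I_4 => X i)) <->
  (forall a b c d : A, pfaff4 a b c d = 0).
Proof.
move=> nil3.
have evE (a : nat -> A) : feval a (standard_poly (fun i : 'I_4 => X i)) =
    pfaff4 (a 0) (a 1) (a 2) (a 3) *+ 2.
  rewrite rmorph_standard_poly -standard_poly4 //; congr standard_poly.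
  by apply/funext => i; exact: feval_var.
split=> [IdA a b c d|pfaff0 a]; last by rewrite evE pfaff0 mul0rn.
apply: (mulrn_eq0_char0 charK0 (n := 1)).
by have := IdA (nth 0 [:: a; b; c; d]); rewrite evE.
Qed.

Lemma relfree_nil3 n (a b c d : relfree K n 3 isT) : ⟦⟦a, b, c⟧, d⟧ = 0.
Proof.
move: a b c d; apply/Id_lncomm4/Id_relfreeP => h.
rewrite rmorph_lncomm /= !feval_var => J [_ SJ]; apply: SJ.
by exists [tuple freealg_incl (h 0%N); freealg_incl (h 1%N);
  freealg_incl (h 2%N); freealg_incl (h 3%N)].
Qed.

Section ThreeGenerators.
Variables (A : algType K) (g : 'I_3 -> A).
Hypothesis nil3 : forall a b c d : A, ⟦⟦a, b, c⟧, d⟧ = 0.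
Local Notation ev := (feval g).

Lemma pfaff4_1 (b c d : A) : pfaff4 1 b c d = 0.
Proof. by rewrite /pfaff4 !comm2_1l !mul0r subr0 addr0. Qed.

Lemma pfaff4_linear k (a a' b c d : A) :
  pfaff4 (k *: a + a') b c d = k *: pfaff4 a b c d + pfaff4 a' b c d.
Proof.
rewrite /pfaff4 !comm2Dl !comm2Zl !(mulrDl (k *: _)) -!scalerAl.
rewrite scalerDr scalerBr opprD.
by rewrite [RHS]addrACA; congr (_ + _); exact: addrACA.
Qed.

Let tf3 (a : A) : a *+ 3 = 0 -> a = 0 := mulrn_eq0_char0 charK0 (n := 2) (a := a).

Lemma pfaff4_subalgebra b c d : (forall i, pfaff4 (g i) b c d = 0) ->
  forall f, pfaff4 (ev f) b c d = 0.
Proof.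
move=> gen0; have pf0 : pfaff4 0 b c d = 0.
  by rewrite /pfaff4 /comm2 !(mul0r, mulr0, subr0, addr0).
elim/freealg_ind=> [|i|f f' IHf IHf'|f f' IHf IHf'|k f IHf].
- by rewrite rmorph1 pfaff4_1.
- by rewrite feval_var.
- rewrite rmorphD /= -[ev f]scale1r pfaff4_linear IHf IHf' scale1r.
  by rewrite addr0.
- by rewrite rmorphM /= pfaff4_M // IHf IHf' !mulr0 addr0.
- by rewrite linearZ /= -[k *: _]addr0 pfaff4_linear IHf pf0 scaler0 addr0.
Qed.

(** Two of the four indices coincide. *)
Lemma pfaff4_three_letters i j k l : pfaff4 (g i) (g j) (g k) (g l) = 0.
Proof.
have : ~~ uniq [:: i; j; k; l].
  by apply/negP => /card_uniqP card4; have := max_card (mem [:: i; j; k; l]);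
    rewrite card4 card_ord.
rewrite /= !negb_and !negbK !inE /= !orbF -!orbA.
have eq23 (a b c : A) : pfaff4 a b b c = 0.
  by rewrite /pfaff4 comm2xx mulr0 addr0 subrr.
have eq12 (a b c : A) : pfaff4 a a b c = 0 by exact: pfaff4_diag.
have eq13 (a b c : A) : pfaff4 a b a c = 0 by rewrite pfaff4_swap23 eq12 oppr0.
have eq34 (a b c : A) : pfaff4 a b c c = 0.
  by rewrite /pfaff4 comm2xx mulr0 sub0r addNr.
case/orP => [/eqP->|]; first exact: eq12.
case/orP => [/eqP->|]; first exact: eq13.
case/orP => [/eqP->|]; first by rewrite pfaff4_swap34 eq13 oppr0.
case/orP => [/eqP->|]; first exact: eq23.
case/orP => [/eqP->|/eqP->]; last exact: eq34.
by rewrite pfaff4_swap34 eq23 oppr0.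
Qed.

(** The Leibniz rule extends the vanishing from generators to the algebra, one
    argument at a time; the swaps bring each argument to the front. *)
Lemma pfaff4_three_gen f1 f2 f3 f4 : pfaff4 (ev f1) (ev f2) (ev f3) (ev f4) = 0.
Proof.
have P1 f i j k : pfaff4 (ev f) (g i) (g j) (g k) = 0.
  by apply: pfaff4_subalgebra => l; exact: pfaff4_three_letters.
have P2 f f' i j : pfaff4 (ev f) (ev f') (g i) (g j) = 0.
  by apply: pfaff4_subalgebra => l; rewrite pfaff4_swap12 // P1 oppr0.
have P3 f f' f'' i : pfaff4 (ev f) (ev f') (ev f'') (g i) = 0.
  apply: pfaff4_subalgebra => l.
  by rewrite pfaff4_swap12 // pfaff4_swap23 P2 !oppr0.
apply: pfaff4_subalgebra => l.
by rewrite pfaff4_swap12 // pfaff4_swap23 pfaff4_swap34 P3 !oppr0.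
Qed.
End ThreeGenerators.

Lemma relfree3_pfaff0 (a b c d : relfree K 3 3 isT) : pfaff4 a b c d = 0.
Proof.
pose g i : relfree K 3 3 isT :=
  aqpi (relfree_ideal K 3 (isT : (0 < 3)%N)) (fvar K i).
have gE (e : relfree K 3 3 isT) : e = feval g (repr e).
  rewrite -[e in LHS]aqpi_repr -[repr e in LHS]feval_fvar.
  exact: (feval_comp (aqpi _)).
rewrite (gE a) (gE b) (gE c) (gE d); apply: pfaff4_three_gen.
exact: relfree_nil3.
Qed.
End StandardIdentity.

(** * The quotient of the free algebra by a T-ideal *)

Section TIdealQuotient.
Variables (K : fieldType) (T : set (freealg K nat)).
Hypotheses (TT : T_ideal T) (T1 : ~ T 1).

Definition T_ideal_proper := ProperTwoSidedIdeal (T_ideal_ideal TT) T1.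

Lemma sub_Id_quotient : T `<=` Id (algquot T_ideal_proper).
Proof.
move=> f Tf a; pose b i := repr (a i).
have -> : a = fun i => aqpi T_ideal_proper (b i).
  by apply/funext => i; rewrite aqpi_repr.
rewrite -(feval_comp (aqpi _)) -(raddf0 (aqpi T_ideal_proper)); apply/aqpiP.
by rewrite subr0; exact: (T_ideal_feval b TT Tf).
Qed.

Lemma feval_quotient_eq0 f :
  feval (fun i => aqpi T_ideal_proper (fvar K i)) f = 0 <-> T f.
Proof.
rewrite -(feval_comp (aqpi _)) feval_fvar -(raddf0 (aqpi T_ideal_proper)).
by rewrite aqpiP subr0.
Qed.
End TIdealQuotient.

(** * The identities of F_2 and F_3 *)

Local Close Scope ring_scope.

Theorem theorem3p9 (K : fieldType) (charK0 : [pchar K]%R =i pred0) :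
  let x (i : nat) : freealg K nat := fvar K i in
  Id (relfree K 2 3 isT) = Id (relfree K 3 3 isT) /\
  Id (relfree K 3 3 isT) =
    T_ideal_gen [set lncomm [:: x 0; x 1; x 2; x 3];
                     standard_poly (fun i : 'I_4 => x i)].
Proof.
move=> x; set S := [set _; _]; set J := Id (relfree K 2 3 isT).
have T_Id3 : T_ideal_gen S `<=` Id (relfree K 3 3 isT).
  move=> f; apply; split; first exact: Id_T_ideal.
  move=> _ [->|->]; first exact/Id_lncomm4/relfree_nil3.
  apply/(Id_standard4 charK0); first exact: relfree_nil3.
  exact: relfree3_pfaff0.
have Id3_J : Id (relfree K 3 3 isT) `<=` J by exact: Id_relfree_leq.
have TT := T_ideal_gen_ideal S.
have T1 : ~ T_ideal_gen S 1%R.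
  move=> /T_Id3 /(_ (fun=> 0%R)); rewrite rmorph1 => /eqP.
  by rewrite oner_eq0.
have S_T f : S f -> Id (algquot (T_ideal_proper TT T1)) f.
  by move=> Sf; apply: sub_Id_quotient => T' [_]; exact.
have nil3 := (Id_lncomm4 _).1 (S_T _ (or_introl erefl)).
have pfaff0 := (Id_standard4 charK0 nil3).1 (S_T _ (or_intror erefl)).
have J_T : J `<=` T_ideal_gen S.
  have [u [v [z [[uvz uz vz] [z2u z2v z2]]]]] := heis_matrices K.
  move=> f Jf; apply/(feval_quotient_eq0 TT T1).
  apply: (Id_relfree2_feval0 charK0 nil3 pfaff0 _ uvz uz vz z2u z2v z2 Jf).
  by move=> f' /feval_quotient_eq0 /T_Id3 /Id3_J.
by split; apply/seteqP; split=> // f; [move/J_T/T_Id3 | move/Id3_J/J_T].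
Qed.
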